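(* Let $\mathfrak g$ be a finite-dimensional Lie algebra over a field $\mathbb K$ of characteristic zero, $G$ a $\mathfrak g$-module, and $V=(V^\bullet,d^V)$ a resolution of $G$. For every Loday–Pirashvili module $(G,X)$ over $\mathfrak g$, there exists a unique dg Loday–Pirashvili class $(V,[\alpha])$ which is a dg lift of $(G,X)$.
   Context: A dg $\mathfrak g$-module is a bounded cochain complex $(V^\bullet,d^V)$ of $\mathfrak g$-modules with $\mathfrak g$-equivariant differentials. $V$ is a resolution of $G$ if $V^i=0$ for $i<0$, $G\cong\ker d^V_0$ as $\mathfrak g$-modules, and $\ker d^V_i=\mathrm{im}\,d^V_{i-1}$ for $i\ge1$. A Loday–Pirashvili module $(G,X)$ is a $\mathfrak g$-module $G$ with a linear map $X\colon G\to\mathfrak g$ satisfying $X(x\triangleright g)=[x,X(g)]$; a morphism $(G,X)\to(H,Y)$ is a $\mathfrak g$-module map $\varphi$ with $Y\circ\varphi=X$. For a dg $\mathfrak g$-module $W$, $\Omega_{\mathfrak g}(W)=\wedge^\bullet\mathfrak g^\vee\otimes W$ (degree $p+q$ on $\wedge^p\mathfrak g^\vee\otimes W^q$) with total differential $d^W_{\mathrm{tot}}=d^W_{\mathrm{CE}}+d^W$, $d^W_{\mathrm{CE}}$ the Chevalley–Eilenberg differential and $d^W(\omega\otimes w)=(-1)^p\omega\otimes d^Ww$. A dg Loday–Pirashvili module is a pair $(V,\alpha)$ with $V$ a non-negative bounded dg $\mathfrak g$-module and $\alpha\colon\Omega_{\mathfrak g}(V)\to\Omega_{\mathfrak g}(\mathfrak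 g)$ a degree $0$ $\Omega_{\mathfrak g}$-linear map with $\alpha\circ d^V_{\mathrm{tot}}=d^{\mathfrak g}_{\mathrm{CE}}\circ\alpha$ (here $\mathfrak g$ is in degree $0$ with the adjoint action); its component $V^0\to\mathfrak g$ is denoted $\alpha_0$. Two such $\alpha,\alpha'$ on $V$ are homotopic if $\alpha'-\alpha=d^{\mathfrak g}_{\mathrm{CE}}\circ h+h\circ d^V_{\mathrm{tot}}$ for a degree $-1$ $\Omega_{\mathfrak g}$-linear $h$; a dg Loday–Pirashvili class $(V,[\alpha])$ is $V$ together with the homotopy class of $\alpha$. Its image under $\mathbf H^0$ is the Loday–Pirashvili module $(\mathbf H^0(V),\mathbf H^0(\alpha))$ where $\mathbf H^0(V)=\ker d^V_0$ and $\mathbf H^0(\alpha)=\alpha_0|_{\ker d^V_0}$ (independent of the representative). A dg lift of $(G,X)$ is a dg Loday–Pirashvili class $(V,[\alpha])$ such that $(\mathbf H^0(V),\mathbf H^0(\alpha))\cong(G,X)$ as Loday–Pirashvili modules.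
   Formalization: The dg lift condition is taken with respect to the fixed isomorphism of G with ker d_0 that is part of the resolution (α_0 restricted to G equals X); with an arbitrary isomorphism uniqueness fails, e.g. X and 2X both lift when g and G are one-dimensional and trivial. *)

(* Defs.v *)
From HB Require Import structures.
From mathcomp Require Import all_boot all_order all_algebra.
From mathcomp Require Import fingroup perm.
Set Implicit Arguments. Unset Strict Implicit. Unset Printing Implicit Defensive.
Import Order.TTheory GRing.Theory Num.Theory.
Local Open Scope ring_scope.

Section LP.
Variables (K : fieldType) (g : vectType K) (br : g -> g -> g).

Definition islin (A B : lmodType K) (f : A -> B) :=
  forall (a : K) (x y : A), f (a *: x + y) = a *: f x + f y.

Definition bilin (A B C : lmodType K) (f : A -> B -> C) :=
  (forall (a : K) x y z, f (a *: x + y) z = a *: f x z + f y z) /\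
  (forall (a : K) z x y, f z (a *: x + y) = a *: f z x + f z y).

Definition is_lie :=
  [/\ bilin br, forall x, br x x = 0 &
      forall x y z, br x (br y z) + br y (br z x) + br z (br x y) = 0].

Definition is_gmod (M : lmodType K) (act : g -> M -> M) :=
  bilin act /\
  forall x y m, act (br x y) m = act x (act y m) - act y (act x m).

Definition is_LP (G : lmodType K) (actG : g -> G -> G) (X : G -> g) :=
  islin X /\ forall x m, X (actG x m) = br x (X m).

Definition is_dgmod (V : nat -> lmodType K) (act : forall q, g -> V q -> V q)
    (d : forall q, V q -> V q.+1) :=
  [/\ forall q, is_gmod (act q), forall q, islin (d q),
      forall q x v, d q (act q x v) = act q.+1 x (d q v),
      forall q v, d q.+1 (d q v) = 0 &
      exists N, forall q, (N < q)%N -> forall v : V q, v = 0].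

Definition is_resolution (G : lmodType K) (actG : g -> G -> G)
    (V : nat -> lmodType K) (act : forall q, g -> V q -> V q)
    (d : forall q, V q -> V q.+1) (iota : G -> V 0%N) :=
  [/\ islin iota, forall x m, iota (actG x m) = act 0%N x (iota m),
      injective iota,
      forall v, d 0%N v = 0 <-> exists m, v = iota m &
      forall q (v : V q.+1), d q.+1 v = 0 -> exists w, v = d q w].

Definition xn p (x : 'I_p -> g) (k : nat) : g :=
  (fun o : option 'I_p => if o is Some i then x i else 0) (insub k).

Definition multilinear (M : lmodType K) p (c : ('I_p -> g) -> M) :=
  forall (x : 'I_p -> g) (i : 'I_p) (a : K) (y z : g),
    c (fun j => if j == i then a *: y + z else x j) =
    a *: c (fun j => if j == i then y else x j) + c (fun j => if j == i then z else x j).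

Definition alternating (M : lmodType K) p (c : ('I_p -> g) -> M) :=
  forall (x : 'I_p -> g) (i j : 'I_p), i != j -> x i = x j -> c x = 0.

Definition cochain (M : lmodType K) p (c : ('I_p -> g) -> M) :=
  multilinear c /\ alternating c.

(* k-th index of {0,1,...} \ {i,j}, for i < j *)
Definition skip2 (i j k : nat) : nat :=
  if (k < i)%N then k else if (k.+1 < j)%N then k.+1 else k.+2.

Definition ce (M : lmodType K) (act : g -> M -> M) p (c : ('I_p -> g) -> M)
    : ('I_p.+1 -> g) -> M := fun x =>
  \sum_(i < p.+1) (-1) ^+ i *: act (x i) (c (fun k => x (lift i k)))
  + \sum_(i < p.+1) \sum_(j < p.+1 | (i < j)%N)
      (-1) ^+ (i + j) *:
        c (fun k : 'I_p => if val k == 0%N then br (x i) (x j)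
                           else xn x (skip2 i j (val k).-1)).

Definition wedge_sum (M : lmodType K) a p (om : ('I_a -> g) -> K)
    (c : ('I_(p - a) -> g) -> M) (x : 'I_p -> g) : M :=
  if (a <= p)%N then
    ((a`! * (p - a)`!)%:R)^-1 *:
      \sum_(s : 'S_p)
        ((-1) ^+ s * om (fun i => xn (fun k => x (s k)) i)) *:
          c (fun j => xn (fun k => x (s k)) (a + j))
  else 0.

Unset Implicit Arguments.
Section Omega.
Variables (V : nat -> lmodType K) (act : forall q, g -> V q -> V q)
          (d : forall q, V q -> V q.+1).

(* element of Omega_g(V): components in wedge^p g^vee (x) V^q *)
Definition OmV := forall p q, ('I_p -> g) -> V q.
(* element of Omega_g(g), g in degree 0: components in wedge^p g^vee (x) g *)
Definition Omg := forall p, ('I_p -> g) -> g.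

Definition validV (F : OmV) := forall p q, cochain (F p q).
Definition validg (A : Omg) := forall p, cochain (A p).

Definition eqV (F F' : OmV) := forall p q x, F p q x = F' p q x.
Definition eqg (A A' : Omg) := forall p x, A p x = A' p x.

Definition addV (F F' : OmV) : OmV := fun p q x => F p q x + F' p q x.
Definition addg (A A' : Omg) : Omg := fun p x => A p x + A' p x.

Definition homV (n : int) (F : OmV) := forall p q x, (p + q)%N%:Z != n -> F p q x = 0.
Definition homg (n : int) (A : Omg) := forall p x, p%:Z != n -> A p x = 0.

Definition dCEV (F : OmV) : OmV := fun p q =>
  match p as p0 return ('I_p0 -> g) -> V q with
  | 0%N => fun _ => 0
  | p'.+1 => ce (@act q) (F p' q)
  end.

Definition dVV (F : OmV) : OmV := fun p q =>
  match q as q0 return ('I_p -> g) -> V q0 with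
  | 0%N => fun _ => 0
  | q'.+1 => fun x => (-1) ^+ p *: @d q' (F p q' x)
  end.

Definition dtot (F : OmV) : OmV := addV (dCEV F) (dVV F).

Definition dCEg (A : Omg) : Omg := fun p =>
  match p as p0 return ('I_p0 -> g) -> g with
  | 0%N => fun _ => 0
  | p'.+1 => ce br (A p')
  end.

Definition wedgeV a (om : ('I_a -> g) -> K) (F : OmV) : OmV :=
  fun p q x => wedge_sum om (F (p - a)%N q) x.
Definition wedgeg a (om : ('I_a -> g) -> K) (A : Omg) : Omg :=
  fun p x => wedge_sum om (A (p - a)%N) x.

(* Omega_g-linear map of degree k (Koszul sign convention) *)
Definition OmLinear (k : int) (alpha : OmV -> Omg) :=
  [/\ forall F F', eqV F F' -> eqg (alpha F) (alpha F'),
      forall F, validV F -> validg (alpha F),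
      forall F F', validV F -> validV F' ->
        eqg (alpha (addV F F')) (addg (alpha F) (alpha F')),
      forall (n : int) F, validV F -> homV n F -> homg (n + k) (alpha F) &
      forall a (om : ('I_a -> g) -> K^o) F, cochain om -> validV F ->
        eqg (alpha (wedgeV a om F))
            (fun p x => (-1) ^+ (odd `|k| * a)%N *: wedgeg a om (alpha F) p x)].

Definition is_dgLP (alpha : OmV -> Omg) :=
  OmLinear 0 alpha /\
  forall F, validV F -> eqg (alpha (dtot F)) (dCEg (alpha F)).

Definition homotopic (alpha alpha' : OmV -> Omg) :=
  exists h : OmV -> Omg, OmLinear (-1) h /\
    forall F, validV F ->
      eqg (alpha' F) (addg (addg (alpha F) (dCEg (h F))) (h (dtot F))).

(* the generator 1 (x) v for v in V^0 *)
Definition genV0 (v : V 0%N) : OmV := fun p q =>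
  match q as q0 return ('I_p -> g) -> V q0 with
  | 0%N => fun _ => if p == 0%N then v else 0
  | _.+1 => fun _ => 0
  end.

Definition alpha0 (alpha : OmV -> Omg) (v : V 0%N) : g :=
  alpha (genV0 v) 0%N (fun _ => 0).

(* (V,[alpha]) is a dg lift of (G,X), H^0(V) identified with G via iota *)
Definition is_dg_lift (G : lmodType K) (iota : G -> V 0%N) (X : G -> g)
    (alpha : OmV -> Omg) :=
  forall m, alpha0 alpha (iota m) = X m.

End Omega.
End LP.

(* Main.v *)
Require Import Defs.
From HB Require Import structures.
From mathcomp Require Import all_boot all_order all_algebra.
From mathcomp Require Import fingroup perm.
From mathcomp Require Import boolp classical_sets functions.
Set Implicit Arguments. Unset Strict Implicit. Unset Printing Implicit Defensive.
Import GRing.Theory.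
Local Open Scope ring_scope.

(* Choose a linear contraction [s] of the resolution onto [G] (Zorn) and extend it to
   [S] on [Omega(V)]. The map [E = 1 - (D S + S D)], with [D] the total differential,
   is Omega-linear, commutes with [D], and equals [T + J], where [J] is the projection
   of [V^0] onto [G] and [T] lowers the degree in [V] by one, with [T J = 0]. As [V] is
   bounded, [T] is nilpotent, so [E^n] takes values in [Omega(G)] for large [n]; hence
   [X o E^n] is a lift of [X]. If [beta] is the difference of two lifts, it vanishes on
   [Omega(G)], so [beta o E^n = 0] and [h = sum_(k < n) beta o E^k o S] is a homotopy
   from [0] to [beta]. *)

(** * Alternating cochains and the Chevalley-Eilenberg differential *)

(** The obstacle is equivariance: the contraction of the resolution is only linear, so the induced
    projection of $\Omega(V)$ onto $\Omega(G)$ need not commute with $D$. The operator $T$ is built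
    from the failure of $s$ to commute with the action; iterating $E$ pushes this failure out of the
    bounded range of $V$. A form is encoded as a family of alternating maps, not as a sum of
    tensors, so generation of $\Omega(G)$ over $\Omega_{\mathfrak g}$ by $1\otimes G$ has to be
    proved. It follows from the identity $\sum_j e^j\wedge i_{e_j}F=pF$ for $F$ of form degree $p$,
    which takes a finite basis of $\mathfrak g$ and division by $p$. The other use of characteristic
    zero is the factorial normalisation of the wedge product. On the generators $1\otimes m$ the
    difference of two lifts is $X(m)-X(m)=0$, whence its vanishing on $\Omega(G)$. *)

Section Linear.
Variables (K : fieldType) (A B : lmodType K) (f : A -> B).
Hypothesis f_lin : islin f.

Lemma islinD x y : f (x + y) = f x + f y.
Proof. by have := f_lin 1 x y; rewrite !scale1r. Qed.

Lemma islin0 : f 0 = 0.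
Proof. by apply: (@addrI _ (f 0)); rewrite -islinD !addr0. Qed.

Lemma islinZ a x : f (a *: x) = a *: f x.
Proof. by have := f_lin a x 0; rewrite islin0 !addr0. Qed.

Lemma islinN x : f (- x) = - f x.
Proof. by rewrite -scaleN1r islinZ scaleN1r. Qed.

Lemma islinB x y : f (x - y) = f x - f y.
Proof. by rewrite islinD islinN. Qed.

Lemma islin_sum (I : Type) (r : seq I) (P : pred I) (F : I -> A) :
  f (\sum_(i <- r | P i) F i) = \sum_(i <- r | P i) f (F i).
Proof. exact: (big_morph f islinD islin0). Qed.

End Linear.

Section Cochains.
Variables (K : fieldType) (g : vectType K).

Definition scons p (z : g) (y : 'I_p -> g) : 'I_p.+1 -> g :=
  fun i => if unlift ord0 i is Some k then y k else z.

Definition upd p (x : 'I_p -> g) (i : 'I_p) (v : g) : 'I_p -> g :=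
  fun j => if j == i then v else x j.

Lemma scons0 p z (y : 'I_p -> g) : scons z y ord0 = z.
Proof. by rewrite /scons unlift_none. Qed.

Lemma sconsS p z (y : 'I_p -> g) k : scons z y (lift ord0 k) = y k.
Proof. by rewrite /scons liftK. Qed.

Lemma eq_scons p (x x' : 'I_p.+1 -> g) : x ord0 = x' ord0 ->
  (forall k, x (lift ord0 k) = x' (lift ord0 k)) -> x = x'.
Proof. by move=> e0 eS; apply: funext => i; case: (unliftP ord0 i) => [k|] ->. Qed.

Lemma scons_eta p (x : 'I_p.+1 -> g) :
  scons (x ord0) (fun k => x (lift ord0 k)) = x.
Proof. by apply: eq_scons => [|k]; rewrite ?scons0 ?sconsS. Qed.

Lemma upd_scons0 p z (y : 'I_p -> g) v : upd (scons z y) ord0 v = scons v y.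
Proof.
apply: eq_scons => [|k]; first by rewrite /upd eqxx scons0.
by rewrite /upd !sconsS.
Qed.

Lemma upd_sconsS p z (y : 'I_p -> g) i v :
  upd (scons z y) (lift ord0 i) v = scons z (upd y i v).
Proof.
apply: eq_scons => [|k]; first by rewrite /upd !scons0.
by rewrite /upd !sconsS (inj_eq lift_inj).
Qed.

Lemma upd_id p (x : 'I_p -> g) i : upd x i (x i) = x.
Proof. by apply: funext => j; rewrite /upd; case: eqP => [->|]. Qed.

Lemma updC p (x : 'I_p -> g) i j a b : i != j ->
  upd (upd x i a) j b = upd (upd x j b) i a.
Proof.
move=> ij; apply: funext => k; rewrite /upd; case: (k =P i) => // ->.
by rewrite (negPf ij).
Qed.

Lemma xnE p (y : 'I_p -> g) (i : 'I_p) : xn y i = y i.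
Proof. by rewrite /xn valK. Qed.

Lemma xn_lift p (y : 'I_p.+1 -> g) k :
  xn (fun i : 'I_p => y (lift ord0 i)) k = xn y k.+1.
Proof.
have [ltkp|lepk] := ltnP k p.
  by rewrite -[k]/(val (Ordinal ltkp)) xnE -lift0 xnE.
by rewrite /xn !insubN // -leqNgt.
Qed.

Lemma xn_scons0 p z (y : 'I_p -> g) : xn (scons z y) 0 = z.
Proof. by rewrite -[0%N]/(val (@ord0 p)) xnE scons0. Qed.

Lemma xn_sconsS p z (y : 'I_p -> g) k : xn (scons z y) k.+1 = xn y k.
Proof. by rewrite -xn_lift; congr xn; apply: funext => i; rewrite sconsS. Qed.

Lemma ord0_fun (x y : 'I_0 -> g) : x = y.
Proof. by apply: funext => -[]. Qed.

Variable M : lmodType K.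

(** The interior product $i_z$. A form of positive degree is determined by its contractions, so
    identities between forms are proved below by induction on the degree, without expanding the
    double sum in [ce] each time. *)
Definition ci p (z : g) (c : ('I_p.+1 -> g) -> M) : ('I_p -> g) -> M :=
  fun y => c (scons z y).

Lemma eq_ci p (c c' : ('I_p.+1 -> g) -> M) :
  (forall z, ci z c = ci z c') -> c = c'.
Proof.
move=> e; apply: funext => x; rewrite -(scons_eta x).
exact: (congr1 (fun f => f _) (e (x ord0))).
Qed.

Section Alternating.
Variables (p : nat) (c : ('I_p -> g) -> M).
Hypothesis c_cochain : cochain c.

Lemma cochain_islin x i : islin (fun v => c (upd x i v)).
Proof. by move=> a y z; apply: c_cochain.1. Qed.

Lemma cochain_tperm x i j : i != j ->
  c (fun k => x (tperm i j k)) = - c x.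
Proof.
move=> ij; pose f a b := c (upd (upd x i a) j b).
have f_diag a : f a a = 0.
  apply: (c_cochain.2 _ i j ij); rewrite /upd !eqxx.
  by rewrite (negPf ij).
have fl b : islin (fun a => f a b).
  by move=> k y z; rewrite /f !(updC _ _ _ ij) cochain_islin.
have fr a : islin (f a) by exact: cochain_islin.
have := f_diag (x i + x j).
rewrite (islinD (fl _)) !(islinD (fr _)) !f_diag addr0 add0r => /eqP.
rewrite addrC addr_eq0 => /eqP e; move: e; rewrite /f upd_id.
have -> : upd x j (x j) = x by exact: upd_id.
move=> <-; congr c; apply: funext => k; rewrite /upd.
case: tpermP => [->|->|/eqP/negPf-> /eqP/negPf->] //; rewrite ?eqxx //.
by rewrite (negPf ij).
Qed.

Lemma cochain_perm x (s : 'S_p) : c (fun k => x (s k)) = (-1) ^+ s *: c x.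
Proof.
have [ts -> dts] := prod_tpermP s.
elim: ts dts x => [_|t ts IH /= /andP[dt dts]] x.
  rewrite big_nil odd_perm1 scale1r; congr c.
  by apply: funext => k; rewrite perm1.
rewrite big_cons odd_mul_tperm.
set r := (\prod_(t <- ts) tperm t.1 t.2)%g.
have -> : (fun k => x ((tperm t.1 t.2 * r)%g k)) = (fun k => x (r (tperm t.1 t.2 k))).
  by apply: funext => k; rewrite permM.
rewrite (cochain_tperm (fun l => x (r l))) // IH // signr_addb dt /=.
by rewrite expr1 mulN1r scaleNr.
Qed.

End Alternating.

Lemma cochain_ci p (c : ('I_p.+1 -> g) -> M) z : cochain c -> cochain (ci z c).
Proof.
move=> Hc; split.
- move=> x i a u v; rewrite /ci -!/(upd _ _ _) -!upd_sconsS.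
  exact: cochain_islin.
- move=> x i j ij exij; apply: (Hc.2 _ (lift ord0 i) (lift ord0 j)).
    by rewrite (inj_eq lift_inj).
  by rewrite !sconsS.
Qed.

Lemma ci_islin p (c : ('I_p.+1 -> g) -> M) y : cochain c ->
  islin (fun z => ci z c y).
Proof.
move=> Hc a u v; have := cochain_islin Hc (scons 0 y) ord0 a u v.
by rewrite !upd_scons0.
Qed.

Lemma ciDl p (c : ('I_p.+1 -> g) -> M) a u v : cochain c ->
  ci (a *: u + v) c = a *: ci u c + ci v c.
Proof. by move=> Hc; apply: funext => y; rewrite !fctE (ci_islin _ Hc). Qed.

Lemma ci_diag p (c : ('I_p.+2 -> g) -> M) z : cochain c -> ci z (ci z c) = 0.
Proof.
move=> Hc; apply: funext => y; apply: (Hc.2 _ ord0 (lift ord0 ord0)) => //.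
by rewrite sconsS !scons0.
Qed.

Lemma ci_anti p (c : ('I_p.+2 -> g) -> M) u v : cochain c ->
  ci u (ci v c) = - ci v (ci u c).
Proof.
move=> Hc; apply: funext => y; rewrite !fctE.
have := congr1 (fun f => f y) (ci_diag (u + v) Hc).
have lin1 w := ci_islin (scons w y) Hc.
have lin2 w := ci_islin y (cochain_ci w Hc).
rewrite (islinD (lin2 _)) /=.
have e w : ci w (ci (u + v) c) y = ci w (ci u c) y + ci w (ci v c) y.
  exact: (islinD (lin1 w)).
rewrite !e !(congr1 (fun f => f y) (ci_diag _ Hc)) add0r addr0.
by move/eqP; rewrite addr_eq0 => /eqP.
Qed.

Lemma cochain0 (c : ('I_0 -> g) -> M) : cochain c.
Proof. by split => [x []|x []]. Qed.

Lemma cochain1 (c : ('I_1 -> g) -> M) :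
  (forall y, islin (fun z => ci z c y)) -> cochain c.
Proof.
move=> lin; split => [x i a u v|x i j].
  rewrite -!/(upd _ _ _) (ord1 i) -(scons_eta x) !upd_scons0; exact: lin.
by rewrite (ord1 i) (ord1 j).
Qed.

Lemma cochainS p (c : ('I_p.+2 -> g) -> M) :
  (forall y, islin (fun z => ci z c y)) -> (forall z, cochain (ci z c)) ->
  (forall z, ci z (ci z c) = 0) -> cochain c.
Proof.
move=> lin Hci diag; split.
  move=> x i a u v; rewrite -!/(upd _ _ _) -(scons_eta x).
  case: (unliftP ord0 i) => [k|] ->; last by rewrite !upd_scons0; apply: lin.
  by rewrite !upd_sconsS; apply: (cochain_islin (Hci _)).
(* The entry equal to [z] is moved, up to sign, to the front of [y], where the double contraction by
   [z] vanishes. *)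
have alt0 z y j : y j = z -> c (scons z y) = 0.
  move=> yj; have := cochain_perm (Hci z) y (tperm ord0 j).
  have -> : (fun k => y (tperm ord0 j k)) =
    scons z (fun k => y (tperm ord0 j (lift ord0 k))).
    by apply: eq_scons => [|k]; rewrite ?scons0 ?sconsS ?tpermL.
  rewrite -[ci z c (scons _ _)]/(ci z (ci z c) _) diag => /esym/eqP.
  by rewrite scaler_eq0 signr_eq0 => /eqP.
move=> x i j; rewrite -(scons_eta x).
case: (unliftP ord0 i) => [i'|] ->; case: (unliftP ord0 j) => [j'|] ->.
- rewrite (inj_eq lift_inj) !sconsS => ij e.
  exact: ((Hci (x ord0)).2 _ i' j').
- by move=> _; rewrite sconsS scons0 => e; apply: (alt0 _ _ i').
- by move=> _; rewrite sconsS scons0 => e; apply: (alt0 _ _ j').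
- by rewrite eqxx.
Qed.

Lemma cochain_lin p a (c c' : ('I_p -> g) -> M) :
  cochain c -> cochain c' -> cochain (a *: c + c').
Proof.
move=> Hc Hc'; split.
- move=> x i b u v; rewrite -!/(upd _ _ _) !fctE !(cochain_islin Hc) !(cochain_islin Hc').
  rewrite !scalerDr !scalerA mulrC !addrA; congr (_ + _); rewrite -!addrA.
  by congr (_ + _); rewrite addrC.
- move=> x i j ij e; rewrite !fctE (Hc.2 x i j ij e) (Hc'.2 x i j ij e).
  by rewrite scaler0 addr0.
Qed.

Lemma cochain_zero p : cochain (0 : ('I_p -> g) -> M).
Proof. by split => // x i a u v; rewrite -[RHS]/(a *: 0 + 0) scaler0 addr0. Qed.

Lemma cochainD p (c c' : ('I_p -> g) -> M) :
  cochain c -> cochain c' -> cochain (c + c').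
Proof. by move=> Hc Hc'; rewrite -(scale1r c); apply: cochain_lin. Qed.

Lemma cochainZ p a (c : ('I_p -> g) -> M) : cochain c -> cochain (a *: c).
Proof.
by move=> Hc; rewrite -(addr0 (a *: c)); apply: cochain_lin => //; apply: cochain_zero.
Qed.

Lemma cochainB p (c c' : ('I_p -> g) -> M) :
  cochain c -> cochain c' -> cochain (c - c').
Proof. by move=> Hc Hc'; rewrite -scaleN1r addrC; apply: cochain_lin. Qed.

End Cochains.

Lemma cochain_comp (K : fieldType) (g : vectType K) (M M' : lmodType K) (f : M -> M') p
  (c : ('I_p -> g) -> M) : islin f -> cochain c -> cochain (fun x => f (c x)).
Proof.
move=> Hf Hc; split => [x i a u v|x i j ij e].
  by rewrite Hc.1 Hf.
by rewrite (Hc.2 x i j ij e) (islin0 Hf).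
Qed.

(** * Cartan calculus: Lie derivative, contraction and differential *)

Section ChevalleyEilenberg.
Variables (K : fieldType) (g : vectType K) (br : g -> g -> g).
Hypothesis Hg : is_lie br.
Variables (M : lmodType K) (act : g -> M -> M).
Hypothesis HM : is_gmod br act.

Let br_linr x : islin (br x).
Proof. by move=> a y z; case: Hg => -[_ ->]. Qed.

Let br_linl y : islin (br^~ y).
Proof. by move=> a x z; case: Hg => -[-> _]. Qed.

Let act_linr x : islin (act x).
Proof. by move=> a y z; rewrite HM.1.2. Qed.

Let act_linl m : islin (act^~ m).
Proof. by move=> a x z; rewrite HM.1.1. Qed.

Lemma br_anti x y : br x y = - br y x.
Proof.
have [_ brxx _] := Hg; have := brxx (x + y).
rewrite (islinD (br_linl _)) !(islinD (br_linr _)) !brxx addr0 add0r.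
by move/eqP; rewrite addr_eq0 => /eqP.
Qed.

Lemma is_gmod_adjoint : is_gmod br br.
Proof.
have [Hb _ J] := Hg; split=> // x y z.
rewrite (br_anti (br x y)); have := J x y z => /eqP; rewrite addr_eq0 => /eqP <-.
by rewrite (br_anti z x) (islinN (br_linr y)).
Qed.

(* [locked] keeps unification from seeing a difference of functions in [lie x c]. *)
Definition lie p (x : g) (c : ('I_p -> g) -> M) : ('I_p -> g) -> M :=
  locked (fun y => act x (c y) - \sum_j c (upd y j (br x (y j)))).

Lemma lieE p x (c : ('I_p -> g) -> M) y :
  lie x c y = act x (c y) - \sum_j c (upd y j (br x (y j))).
Proof. by rewrite /lie -lock. Qed.

Lemma lie_islin p x : islin (@lie p x).
Proof.
move=> a c c'; apply: funext => y; rewrite !fctE !lieE act_linr.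
by rewrite big_split -scaler_sumr /= scalerBr opprD addrACA.
Qed.

Lemma lie_linl p (c : ('I_p -> g) -> M) y : cochain c ->
  islin (fun x => lie x c y).
Proof.
move=> Hc a u v; rewrite !lieE act_linl scalerBr.
have -> : \sum_j c (upd y j (br (a *: u + v) (y j))) =
    a *: \sum_j c (upd y j (br u (y j))) + \sum_j c (upd y j (br v (y j))).
  rewrite scaler_sumr -big_split; apply: eq_bigr => j _ /=.
  by rewrite br_linl (cochain_islin Hc).
by rewrite opprD addrACA.
Qed.

(** Cartan's relation between $i_z$ and $L_x$; the extra contraction is the summand of [lie] that
    brackets the first argument. *)
Lemma ci_lie p (c : ('I_p.+1 -> g) -> M) x z :
  ci z (lie x c) = lie x (ci z c) - ci (br x z) c.
Proof.
apply: funext => y; rewrite !fctE /ci !lieE big_ord_recl upd_scons0 scons0.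
rewrite -addrA -opprD; congr (_ - _); rewrite addrC; congr (_ + _).
by apply: eq_bigr => j _; rewrite upd_sconsS sconsS.
Qed.

Lemma ciB p (c c' : ('I_p.+1 -> g) -> M) z : ci z (c - c') = ci z c - ci z c'.
Proof. by []. Qed.

Lemma cochain_lie p (c : ('I_p -> g) -> M) x : cochain c -> cochain (lie x c).
Proof.
elim: p c => [|p IH] c Hc; first exact: cochain0.
have lin y : islin (fun z => ci z (lie x c) y).
  move=> a u v; rewrite !ci_lie ciDl // lie_islin br_linr ciDl // !fctE.
  by rewrite opprD addrACA -scalerBr.
case: p IH c Hc lin => [|p] IH c Hc lin; first exact: cochain1.
apply: cochainS => // z.
  by rewrite ci_lie; apply: cochainB; [apply: IH; exact: cochain_ci | exact: cochain_ci].
rewrite ci_lie ciB ci_lie ci_diag // (islin0 (@lie_islin p x)) sub0r.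
by rewrite ci_anti // opprK subrr.
Qed.

(** In degree $0$ this is the module axiom; the induction step is the Jacobi identity, in the form
    that the adjoint action is a module. *)
Lemma lie_br p (c : ('I_p -> g) -> M) x y : cochain c ->
  lie (br x y) c = lie x (lie y c) - lie y (lie x c).
Proof.
elim: p c => [|p IH] c Hc.
  apply: funext => z; rewrite !fctE !lieE !big_ord0 !subr0 /=.
  by rewrite HM.2.
apply: eq_ci => z; rewrite ciB !ci_lie !(islinB (@lie_islin p _)) IH; last exact: cochain_ci.
rewrite is_gmod_adjoint.2.
have -> : ci (br x (br y z) - br y (br x z)) c =
    ci (br x (br y z)) c - ci (br y (br x z)) c.
  by apply: funext => w; exact: (islinB (ci_islin w Hc)).
set A := lie x (lie y _); set B := lie y (lie x _); set u := ci _ c; set v := ci _ c.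
set e := lie x _; set f := lie y _.
by rewrite !opprB [RHS]addrACA !subrKA [v - B]addrC [RHS]addrACA [- u + v]addrC.
Qed.

Lemma ce_islin p : islin (@ce K g br M act p).
Proof.
move=> a c c'; apply: funext => x; rewrite /ce !fctE.
rewrite scalerDr [RHS]addrACA !scaler_sumr; congr (_ + _).
  rewrite -big_split; apply: eq_bigr => i _ /=.
  by rewrite act_linr scalerDr !scalerA mulrC.
rewrite -big_split; apply: eq_bigr => i _ /=; rewrite scaler_sumr -big_split /=.
by apply: eq_bigr => j _; rewrite scalerDr !scalerA mulrC.
Qed.

Lemma ci_ce0 (c : ('I_0 -> g) -> M) z : ci z (ce br act c) = lie z c.
Proof.
apply: funext => y; rewrite /ci /ce lieE big_ord0 subr0 !big_ord1 scale1r scons0.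
rewrite big_mkcond big_ord1 /= addr0; congr (act z (c _)).
exact: ord0_fun.
Qed.

Lemma scons_lift p z (y : 'I_p.+1 -> g) i :
  (fun k => scons z y (lift (lift ord0 i) k)) = scons z (fun k => y (lift i k)).
Proof.
apply: eq_scons => [|k].
  rewrite scons0; have -> : lift (lift ord0 i) ord0 = ord0 by apply: val_inj.
  by rewrite scons0.
rewrite sconsS -(sconsS z y); congr scons; apply: val_inj.
by rewrite /= /bump /= !add1n ltnS addnS.
Qed.

Lemma skip2_scons0 p v z (y : 'I_p.+1 -> g) (j : 'I_p.+1) :
  (fun k : 'I_p.+1 => if val k == 0%N then v
     else xn (scons z y) (skip2 0 (lift ord0 j) (val k).-1)) =
  scons v (fun k => y (lift j k)).
Proof.
apply: eq_scons => [|k]; rewrite ?scons0 ?sconsS //.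
rewrite lift0 /= -(xnE y); rewrite -[RHS](xn_sconsS z); congr (xn _ _).
by rewrite /skip2 /= /bump !add0n ltnS; case: ltnP.
Qed.

(** In [ce] the bracket [v] precedes [z], after contraction [z] precedes [v]. This transposition
    provides one of the signs in Cartan's formula. *)
Lemma skip2_sconsS p v z (y : 'I_p.+2 -> g) (i j : 'I_p.+2) :
  (fun k : 'I_p.+2 => if val k == 0%N then v
     else xn (scons z y) (skip2 (lift ord0 i) (lift ord0 j) (val k).-1)) =
  (fun k => scons z (fun k : 'I_p.+1 => if val k == 0%N then v
     else xn y (skip2 i j (val k).-1)) (tperm ord0 (lift ord0 ord0) k)).
Proof.
apply: eq_scons => [|k]; first by rewrite tpermL sconsS.
rewrite lift0 /=; case: (unliftP ord0 k) => [k'|] ->.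
  rewrite tpermD ?(inj_eq lift_inj) // sconsS lift0 /=.
  rewrite -[RHS](xn_sconsS z); congr (xn _ _).
  rewrite /skip2 /= /bump /= !add1n !ltnS.
  by rewrite !add0n; case: ltnP => // _; case: ltnP.
by rewrite tpermR scons0 /= /skip2 xn_scons0.
Qed.

(** Cartan's formula $i_z d + d\,i_z = L_z$. The summand $i=0$ gives the action part of $L_z$, the
    pairs $(0,j)$ its bracket part, and all other terms give $-d\,i_z$. *)
Lemma ci_ceS p (c : ('I_p.+1 -> g) -> M) z : cochain c ->
  ci z (ce br act c) = lie z c - ce br act (ci z c).
Proof.
move=> Hc; apply: funext => y; rewrite !fctE /ci /ce lieE.
rewrite big_ord_recl scale1r scons0 -!addrA; congr (act z (c _) + _).
  by apply: funext => k; rewrite sconsS.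
rewrite opprD addrCA; congr (_ + _).
  rewrite -sumrN; apply: eq_bigr => i _.
  by rewrite lift0 sconsS scons_lift exprS mulN1r scaleNr.
rewrite big_ord_recl; congr (_ + _).
  rewrite big_mkcond big_ord_recl ltnn Monoid.mul1m -sumrN; apply: eq_bigr => j _.
  rewrite scons0 sconsS skip2_scons0 lift0 /= add0n exprS.
  (* [ce] places the bracket first, [lie] places it in slot [j]; the cycle relating the two has sign
     $(-1)^j$. *)
  have -> : scons (br z (y j)) (fun k => y (lift j k)) =
     (fun k => upd y j (br z (y j)) (lift_perm ord0 j 1%g k)).
    apply: eq_scons => [|k]; rewrite ?scons0 ?lift_perm_id /upd ?eqxx //.
    by rewrite sconsS lift_perm_lift perm1 eq_sym (negPf (neq_lift _ _)).
  rewrite (cochain_perm Hc) odd_lift_perm odd_perm1 addbF /= signr_odd.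
  by rewrite scalerA mulN1r mulNr -signr_odd -expr2 sqrr_sign scaleN1r.
rewrite -sumrN; apply: eq_bigr => i _.
rewrite big_mkcond big_ord_recl ltn0 Monoid.mul1m -sumrN [RHS]big_mkcond; apply: eq_bigr => j _.
rewrite !lift0 ltnS; case: ifP => // ltij; rewrite !sconsS.
case: p c Hc y i j ltij => [|p] c Hc y i j ltij.
  by move: ltij; rewrite (ord1 i) (ord1 j).
rewrite -!lift0 skip2_sconsS.
rewrite (cochain_tperm Hc (scons z _)) // scalerN; congr (- (_ *: _)).
by rewrite !lift0 addnS addSn !exprS !mulN1r opprK.
Qed.

(** Alternation comes from Cartan's formula used twice: $i_z i_z d c = -i_{[z,z]}c + d\,i_z i_z c =
    0$. *)
Lemma cochain_ce p (c : ('I_p -> g) -> M) : cochain c -> cochain (ce br act c).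
Proof.
elim: p c => [|p IH] c Hc.
  by apply: cochain1 => y a u v; rewrite !ci_ce0 lie_linl.
apply: cochainS => [y a u v|z|z].
- by rewrite !ci_ceS // ciDl // (@ce_islin p) !fctE lie_linl // opprD addrACA -scalerBr.
- rewrite ci_ceS //; apply: cochainB; first exact: cochain_lie.
  exact/IH/cochain_ci.
rewrite ci_ceS // ciB ci_lie; have [_ brzz _] := Hg; rewrite brzz.
have -> : ci 0 c = 0.
  by apply: funext => y; exact: (islin0 (ci_islin y Hc)).
rewrite subr0; case: p IH c Hc => [|p] _ c Hc; first by rewrite ci_ce0 subrr.
rewrite ci_ceS; last exact: cochain_ci.
by rewrite ci_diag // (islin0 (@ce_islin p)) subr0 subrr.
Qed.

Lemma lie_ce p (c : ('I_p -> g) -> M) x : cochain c ->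
  lie x (ce br act c) = ce br act (lie x c).
Proof.
elim: p c => [|p IH] c Hc; apply: eq_ci => z; rewrite ci_lie.
  by rewrite !ci_ce0 lie_br // opprB addrC subrK.
rewrite !ci_ceS //; last exact: cochain_lie.
rewrite ci_lie (islinB (@lie_islin p.+1 x)) (islinB (@ce_islin p) (lie x _)) lie_br //.
rewrite IH; last exact: cochain_ci.
set A := lie x (lie z c); set B := lie z _; set P := ce _ _ _; set Q := ce _ _ _.
by rewrite !opprB [_ + (B - A)]addrC addrACA [A + _]addrC subrK [- P + Q]addrC.
Qed.

(** Contraction gives $i_z d d = L_z d - d L_z + d d\,i_z$; the first two terms cancel by [lie_ce],
    the third vanishes by induction. *)
Lemma ce_ce p (c : ('I_p -> g) -> M) : cochain c -> ce br act (ce br act c) = 0.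
Proof.
elim: p c => [|p IH] c Hc; apply: eq_ci => z.
  by rewrite ci_ceS ?ci_ce0 ?lie_ce ?subrr //; exact: cochain_ce.
rewrite ci_ceS; last exact: cochain_ce.
rewrite ci_ceS // (islinB (@ce_islin p.+1) (lie z c)) lie_ce // IH; last exact: cochain_ci.
by rewrite subr0 subrr.
Qed.

End ChevalleyEilenberg.

(** * Wedge products *)

Lemma sum_lift_perm (M : nmodType) p (F : 'S_p.+1 -> M) :
  \sum_u F u = \sum_i \sum_t F (lift_perm ord0 i t).
Proof.
rewrite (partition_big (fun u : 'S_p.+1 => u ord0) predT) //=.
apply: eq_bigr => i _; rewrite (reindex (lift_perm ord0 i)) /=.
  by apply: eq_bigl => t; rewrite lift_perm_id eqxx.
(* What is left of [u] once its first value is removed and the others are renumbered. The default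
   [k] is never taken, because [u] is injective. *)
pose low (u : 'S_p.+1) k := odflt k (unlift (u ord0) (u (lift ord0 k))).
have lowK (u : 'S_p.+1) k : lift (u ord0) (low u k) = u (lift ord0 k).
  rewrite /low; have := neq_lift ord0 k.
  by rewrite -(can_eq (permK u)) => /unlift_some[] ? ? ->.
have low_inj u : injective (low u).
  move=> k l e; apply: (@lift_inj _ ord0); apply: (@perm_inj _ u).
  by rewrite -!lowK e.
exists (fun u => perm (@low_inj u)) => [t _|u].
  by apply/permP => k; rewrite permE /low lift_perm_lift lift_perm_id liftK.
rewrite inE => /eqP ui; apply/permP => k.
case: (unliftP ord0 k) => [l|] ->; rewrite ?lift_perm_id //.
by rewrite lift_perm_lift permE -ui lowK.
Qed.

Section Wedge.
Variables (K : fieldType) (g : vectType K).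

(** The arity [p - a] occurs in a type; taking the second factor from a family [F] over all arities
    lets [b] replace it without a cast. *)
Lemma wedge_sumE (M : lmodType K) (F : forall b, ('I_b -> g) -> M) a b p
    (om : ('I_a -> g) -> K) (x : 'I_p -> g) : p = (a + b)%N ->
  wedge_sum om (F (p - a)%N) x = ((a`! * b`!)%:R)^-1 *:
    \sum_(s : 'S_p) ((-1) ^+ s * om (fun i => xn (fun k => x (s k)) i)) *:
      F b (fun j => xn (fun k => x (s k)) (a + j)).
Proof.
move=> e; rewrite /wedge_sum {1}e leq_addr.
have -> // : (p - a)%N = b by rewrite e addKn.
Qed.

Lemma wedge_sum_gt (M : lmodType K) a p (om : ('I_a -> g) -> K)
    (c : ('I_(p - a) -> g) -> M) x : (p < a)%N -> wedge_sum om c x = 0.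
Proof. by move=> ltpa; rewrite /wedge_sum leqNgt ltpa. Qed.

Lemma wedge_sum_comp (M M' : lmodType K) (f : M -> M') a p (om : ('I_a -> g) -> K)
    (c : ('I_(p - a) -> g) -> M) x : islin f ->
  f (wedge_sum om c x) = wedge_sum om (fun y => f (c y)) x.
Proof.
move=> Hf; rewrite /wedge_sum; case: ifP => _; last exact: islin0.
rewrite (islinZ Hf) (islin_sum Hf); congr (_ *: _).
by apply: eq_bigr => s _; rewrite (islinZ Hf).
Qed.

Lemma wedge_sumZl (M : lmodType K) k a p (om : ('I_a -> g) -> K)
    (c : ('I_(p - a) -> g) -> M) x :
  wedge_sum (fun y => k * om y) c x = k *: wedge_sum om c x.
Proof.
rewrite /wedge_sum; case: ifP => _; last by rewrite scaler0.
rewrite [RHS]scalerA [k * _]mulrC -[RHS]scalerA; congr (_ *: _).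
rewrite scaler_sumr.
by apply: eq_bigr => s _; rewrite scalerA mulrCA.
Qed.

Lemma wedge_sumB (M : lmodType K) a p (om : ('I_a -> g) -> K)
    (c c' : ('I_(p - a) -> g) -> M) x :
  wedge_sum om (fun y => c y - c' y) x = wedge_sum om c x - wedge_sum om c' x.
Proof.
rewrite /wedge_sum; case: ifP => _; last by rewrite subr0.
rewrite -scalerBr -sumrB; congr (_ *: _).
by apply: eq_bigr => s _; rewrite scalerBr.
Qed.

Lemma wedge_sumD (M : lmodType K) a p (om : ('I_a -> g) -> K)
    (c c' : ('I_(p - a) -> g) -> M) x :
  wedge_sum om (fun y => c y + c' y) x = wedge_sum om c x + wedge_sum om c' x.
Proof.
rewrite /wedge_sum; case: ifP => _; last by rewrite addr0.
rewrite -scalerDr -big_split; congr (_ *: _).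
by apply: eq_bigr => s _; rewrite scalerDr.
Qed.

Lemma wedge_sum0 (M : lmodType K) a p (om : ('I_a -> g) -> K)
    (c : ('I_(p - a) -> g) -> M) x : (forall y, c y = 0) -> wedge_sum om c x = 0.
Proof.
move=> c0; rewrite /wedge_sum; case: ifP => // _.
by rewrite big1 ?scaler0 // => s _; rewrite c0 scaler0.
Qed.

(** * Compatibility of wedge products with the action part of the differential *)

Section AltSum.
Variables (M M' : lmodType K) (th : g -> M -> M').
Hypothesis th_lin : forall z, islin (th z).

Definition alt_sum p (c : ('I_p -> g) -> M) (x : 'I_p.+1 -> g) : M' :=
  \sum_(i < p.+1) (-1) ^+ i *: th (x i) (c (fun k => x (lift i k))).

Hypothesis HK : [pchar K] =i pred0.

Let natr_neq0 n : (0 < n)%N -> n%:R != 0 :> K.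
Proof. by move/pcharf0P: HK => ->; rewrite lt0n. Qed.

Lemma xn_lift_ord p (x : 'I_p.+1 -> g) (h : 'I_p.+1) k : (k < p)%N ->
  xn (fun i : 'I_p => x (lift h i)) k = xn x (bump h k).
Proof.
move=> ltkp; rewrite -[k in LHS]/(val (Ordinal ltkp)) xnE.
by rewrite -[bump h k]/(val (lift h (Ordinal ltkp))) xnE.
Qed.

(* Both sides are multiples of the antisymmetrisation of [om (x) th (x) c]; the
   sign [(-1)^a] comes from moving the argument of [th] past those of [om]. *)
Lemma alt_sum_wedge (F : forall b, ('I_b -> g) -> M) a b p (om : ('I_a -> g) -> K)
    (x : 'I_p.+1 -> g) : p = (a + b)%N ->
  alt_sum (fun y : 'I_p -> g => wedge_sum om (F (p - a)%N) y) x =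
  (-1) ^+ a *: (((a`! * b.+1`!)%:R)^-1 *:
    \sum_(s : 'S_p.+1) ((-1) ^+ s * om (fun i => xn (fun k => x (s k)) i)) *:
      alt_sum (F b) (fun j => xn (fun k => x (s k)) (a + j))).
Proof.
move=> ep.
pose L := \sum_(u : 'S_p.+1) ((-1) ^+ u * om (fun i => xn (fun k => x (u k)) i.+1)) *:
  th (x (u ord0)) (F b (fun j => xn (fun k => x (u k)) (a + j).+1)).
transitivity (((a`! * b`!)%:R)^-1 *: L).
  rewrite /L sum_lift_perm scaler_sumr; apply: eq_bigr => i _.
  rewrite (@wedge_sumE _ _ a b) // (islinZ (th_lin _)) (islin_sum (th_lin _)).
  rewrite scalerA mulrC -scalerA; congr (_ *: _); rewrite scaler_sumr.
  apply: eq_bigr => t _; rewrite lift_perm_id (islinZ (th_lin _)) scalerA mulrA.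
  have ex k : xn (fun k => x (lift_perm ord0 i t k)) k.+1 =
      xn (fun k0 => x (lift i (t k0))) k.
    by rewrite -xn_lift; congr xn; apply: funext => l; rewrite lift_perm_lift.
  have -> : (-1) ^+ lift_perm ord0 i t = (-1) ^+ i * (-1) ^+ t :> K.
    by rewrite odd_lift_perm /= signr_addb signr_odd.
  by congr (_ * om _ *: th _ (F b _)); apply: funext => j; rewrite ex.
have termE (i : 'I_b.+1) :
  \sum_(s : 'S_p.+1) ((-1) ^+ s * om (fun l => xn (fun k => x (s k)) l)) *:
     ((-1) ^+ i *: th (xn (fun k => x (s k)) (a + i))
       (F b (fun k => xn (fun k => x (s k)) (a + lift i k)))) = (-1) ^+ a *: L.
  have ltP : (a + i < p.+1)%N by rewrite ep ltnS leq_add2l -ltnS.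
  (* The argument of [th] sits at position [a + i]. The cycle [r] brings it to the front with sign
     $(-1)^{a+i}$ and keeps the order of the others; the factor $(-1)^i$ cancels that of
     [alt_sum]. *)
  pose P := Ordinal ltP; pose r := lift_perm ord0 P 1%g.
  rewrite /L [in RHS](reindex_inj (mulgI r)) /= scaler_sumr; apply: eq_bigr => u _.
  have r0 : (r * u)%g ord0 = u P by rewrite permM lift_perm_id.
  have rS k : (k < p)%N ->
      xn (fun k => x ((r * u)%g k)) k.+1 = xn (fun k => x (u k)) (bump P k).
    move=> ltkp; rewrite -(xn_lift_ord (fun k => x (u k))) // -xn_lift.
    congr xn; apply: funext => l.
    by rewrite permM lift_perm_lift perm1.
  rewrite r0 odd_permM signr_addb odd_lift_perm odd_perm1 addbF /= signr_odd.
  have -> : (fun l : 'I_a => xn (fun k => x ((r * u)%g k)) l.+1) =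
      (fun l : 'I_a => xn (fun k => x (u k)) l).
    apply: funext => k; rewrite rS; last by rewrite ep ltn_addr.
    by rewrite /bump /= leqNgt ltn_addr.
  have -> : (fun j : 'I_b => xn (fun k => x ((r * u)%g k)) (a + j).+1) =
      (fun j : 'I_b => xn (fun k => x (u k)) (a + lift i j)).
    apply: funext => k; rewrite rS; last by rewrite ep ltn_add2l.
    by rewrite /= /bump /= leq_add2l addnCA.
  rewrite -[(a + i)%N]/(val P) xnE exprD !scalerA; congr (_ *: _).
  have sq : (-1) ^+ a * (-1) ^+ a = 1 :> K by rewrite -expr2 sqrr_sign.
  by rewrite !mulrA sq mul1r mulrC mulrA.
have -> : \sum_(s : 'S_p.+1) ((-1) ^+ s * om (fun i => xn (fun k => x (s k)) i)) *:
    alt_sum (F b) (fun j => xn (fun k => x (s k)) (a + j)) =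
  \sum_(i < b.+1) (-1) ^+ a *: L.
  rewrite -(eq_bigr _ (fun i _ => termE i)) exchange_big /=.
  by apply: eq_bigr => s _; rewrite /alt_sum scaler_sumr.
(* The $b+1$ positions contribute equally, which turns the normalisation $(b+1)!$ into $b!$. *)
rewrite sumr_const card_ord -scaler_nat !scalerA; congr (_ *: _).
have sq : (-1) ^+ a * (-1) ^+ a = 1 :> K by rewrite -expr2 sqrr_sign.
have na := natr_neq0 (fact_gt0 a); have nb := natr_neq0 (fact_gt0 b).
have nb1 := natr_neq0 (ltn0Sn b).
rewrite mulrA [RHS]mulrC !mulrA sq mul1r factS !natrM !invfM -!mulrA; congr (_ * _).
by rewrite mulrCA mulVf ?mulr1.
Qed.

End AltSum.

(** * Wedging with one-forms, and the recovery of a form from its contractions *)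

Section Alternation.
Hypothesis HK : [pchar K] =i pred0.

Let natr_neq0 n : (0 < n)%N -> n%:R != 0 :> K.
Proof. by move/pcharf0P: HK => ->; rewrite lt0n. Qed.

Variable M : lmodType K.

Lemma upd_perm p (x : 'I_p -> g) i v (s : 'S_p) :
  (fun k => upd x i v (s k)) = upd (fun k => x (s k)) ((s^-1)%g i) v.
Proof.
by apply: funext => k; rewrite /upd (canF_eq (permK s)).
Qed.

Lemma cochain_alternation p (f : ('I_p -> g) -> M) : multilinear f ->
  cochain (fun x => \sum_(s : 'S_p) (-1) ^+ s *: f (fun k => x (s k))).
Proof.
move=> Hf; split => [x i a u v|x i j ij e].
  rewrite -!/(upd _ _ _) scaler_sumr -big_split; apply: eq_bigr => s _ /=.
  by rewrite !upd_perm Hf scalerDr !scalerA mulrC.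
set S := \sum_(s : 'S_p) _.
have SN : S = - S.
  rewrite {1}/S (reindex_inj (mulIg (tperm i j))) /= -sumrN.
  apply: eq_bigr => s _; rewrite odd_permM odd_tperm ij signr_addb mulrN1 scaleNr.
  congr (- (_ *: f _)); apply: funext => k; rewrite permM.
  by case: tpermP => [->|->|] //; rewrite e.
have : 2%:R *: S = 0 by rewrite scaler_nat mulr2n {1}SN addNr.
by move/eqP; rewrite scaler_eq0 (negPf (natr_neq0 _)) //= => /eqP.
Qed.

Lemma wedge1E (F : forall b, ('I_b -> g) -> M) (e : g -> K) p (x : 'I_p.+1 -> g) :
  wedge_sum (fun y : 'I_1 -> g => e (y ord0)) (F (p.+1 - 1)%N) x = (p`!%:R)^-1 *:
    \sum_(s : 'S_p.+1) (-1) ^+ s *: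
      (e (x (s ord0)) *: F p (fun j => x (s (lift ord0 j)))).
Proof.
rewrite (@wedge_sumE _ _ 1 p) // mul1n; congr (_ *: _).
apply: eq_bigr => s _; rewrite scalerA.
rewrite -[nat_of_ord (@ord0 0)]/(val (@ord0 p)) xnE; congr (_ *: F p _).
by apply: funext => j; rewrite add1n -lift0 xnE.
Qed.

Lemma cochain_wedge1 (F : forall b, ('I_b -> g) -> M) (e : g -> K^o) p :
  islin e -> (forall b, cochain (F b)) ->
  cochain (fun x : 'I_p -> g =>
    wedge_sum (fun y : 'I_1 -> g => e (y ord0)) (F (p - 1)%N) x).
Proof.
move=> He HF; case: p => [|p]; first exact: cochain0.
have -> : (fun x : 'I_p.+1 -> g =>
    wedge_sum (fun y : 'I_1 -> g => e (y ord0)) (F (p.+1 - 1)%N) x) =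
  (p`!%:R)^-1 *: (fun x => \sum_(s : 'S_p.+1) (-1) ^+ s *:
     (fun y => e (y ord0) *: F p (fun j => y (lift ord0 j))) (fun k => x (s k))).
  by apply: funext => x; rewrite wedge1E.
pose f (y : 'I_p.+1 -> g) := e (y ord0) *: F p (fun j => y (lift ord0 j)).
suff f_lin x i : islin (fun v => f (upd x i v)).
  apply: cochainZ; apply: (@cochain_alternation _ f) => x i a u v; exact: f_lin.
move=> a u v; rewrite -(scons_eta x); move: (x ord0) (fun k => _) => z {}x.
have tl w (y : 'I_p -> g) : (fun j => scons w y (lift ord0 j)) = y.
  by apply: funext => j; rewrite sconsS.
case: (unliftP ord0 i) => [k|] ->.
  rewrite !upd_sconsS /f !scons0 !tl (cochain_islin (HF p)).
  by rewrite scalerDr !scalerA mulrC.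
by rewrite !upd_scons0 /f !scons0 !tl He scalerDl -scalerA.
Qed.

(** The operator $\sum_j e^j\wedge i_{e_j}$ counts the form degree: each permutation in the wedge
    product reassembles [F] from its first argument expanded in the basis. Dividing by $p+1$
    recovers [F]. *)
Lemma wedge_contraction (F : forall b, ('I_b -> g) -> M) p (x : 'I_p.+1 -> g) :
  cochain (F p.+1) ->
  \sum_(j < \dim (fullv : {vspace g}))
    wedge_sum (fun y : 'I_1 -> g => coord (vbasis fullv) j (y ord0))
      (((p.+1 - 1).+1%:R)^-1 *: ci (vbasis fullv)`_j (F (p.+1 - 1).+1)) x =
  F p.+1 x.
Proof.
move=> HF; set e := vbasis _.
pose G j b : ('I_b -> g) -> M := (b.+1%:R)^-1 *: ci e`_j (F b.+1).
under eq_bigr do rewrite (wedge1E (G _)).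
rewrite -scaler_sumr exchange_big /=.
have termE (s : 'S_p.+1) : \sum_(j < \dim (fullv : {vspace g})) (-1) ^+ s *: (coord e j (x (s ord0)) *:
    G j p (fun j0 => x (s (lift ord0 j0)))) = (p.+1%:R)^-1 *: F p.+1 x.
  rewrite -scaler_sumr /G.
  have -> : \sum_(j < \dim (fullv : {vspace g})) coord e j (x (s ord0)) *:
      ((p.+1%:R)^-1 *: ci e`_j (F p.+1)) (fun j0 => x (s (lift ord0 j0))) =
    (p.+1%:R)^-1 *: F p.+1 (fun k => x (s k)).
    rewrite -(scons_eta (fun k => x (s k))) -[F _ (scons _ _)]/(ci _ _ _).
    rewrite {2}(coord_vbasis (memvf (x (s ord0)))) (islin_sum (ci_islin _ HF)).
    rewrite scaler_sumr; apply: eq_bigr => j _; rewrite (islinZ (ci_islin _ HF)).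
    by rewrite !fctE !scalerA mulrC.
  by rewrite (cochain_perm HF) !scalerA mulrAC -expr2 sqrr_sign mul1r.
rewrite (eq_bigr _ (fun s _ => termE s)) sumr_const card_Sn -scaler_nat !scalerA.
rewrite factS natrM -!mulrA.
rewrite [p.+1%:R * _]mulrCA mulfV ?natr_neq0 // mulr1 mulVf ?scale1r //.
by rewrite natr_neq0 ?fact_gt0.
Qed.

End Alternation.
End Wedge.

(** * Linear splittings *)

Section Splitting.
Variables (K : fieldType).

(* Zorn's lemma on the graphs of partial linear sections of [f]. *)
Lemma linear_section (A B : lmodType K) (f : A -> B) : islin f ->
  exists t : B -> A, islin t /\ forall a, f (t (f a)) = f a.
Proof.
move=> Hf.
(* The domain of [R] may leave the image of [f], as the section condition is imposed only over that
   image. A maximal [R] is then defined on all of [B]. *)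
pose good (R : set (B * A)) :=
  [/\ forall k b a b' a', R (b, a) -> R (b', a') -> R (k *: b + b', k *: a + a'),
      forall a, R (0, a) -> a = 0 &
      forall c a, R (f c, a) -> f a = f c].
have [F FP Ftot|R [[Rlin Rfun Rsec] Rmax]] := @Zorn_bigcup _ good.
  split=> [k b a b' a' [X FX Xba] [Y FY Yba]|a [X FX]|c a [X FX]].
  - have [XY|YX] := Ftot _ _ FX FY.
      by exists Y => //; have [lin _ _] := FP _ FY; apply: lin => //; exact: XY.
    by exists X => //; have [lin _ _] := FP _ FX; apply: lin => //; exact: YX.
  - by have [_ fn _] := FP _ FX; apply: fn.
  - by have [_ _ sec] := FP _ FX; apply: sec.
(* The empty relation is [good], so a maximal one has to be shown nonempty. *)
have R0 : R (0, 0).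
  apply: contrapT => nR0.
  have Re b a : ~ R (b, a).
    by move=> Rba; apply: nR0; have := Rlin (-1) _ _ _ _ Rba Rba; rewrite !scaleN1r !addNr.
  apply: (Rmax [set (0, 0)]%classic).
    split; first by case=> b a /Re.
    by move=> sub; apply: nR0; exact: sub.
  split=> [k b a b' a' [-> ->] [-> ->]|a [//]|c a [-> ->]].
    by rewrite !scaler0 !addr0.
  exact: islin0.
have Rtot b0 : exists a, R (b0, a).
  apply: contrapT => nb0.
  (* If the coset of [b0] modulo the domain of [R] meets the image of [f], say [b + b0 = f c] with
     [R (b, a)], then [c - a] is a suitable value at [b0]. Otherwise the choice is free, and [0] is
     taken. *)
  have [a0 Ha0] : exists a0, forall b a k c, R (b, a) -> b + k *: b0 = f c ->
      f (a + k *: a0) = f c.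
    have [[b [a [c [Rba e]]]]|no] := pselect (exists b a c, R (b, a) /\ b + b0 = f c).
      exists (c - a) => b' a' k c' Rba' e'.
      have Rk : R (b' - k *: b, a' - k *: a).
        by rewrite addrC -scaleNr [a' - _]addrC -scaleNr; apply: Rlin.
      have ek : b' - k *: b = f (c' - k *: c).
        rewrite (islinB Hf) (islinZ Hf) -e -e' scalerDr opprD addrACA.
        by rewrite subrr addr0.
      rewrite ek in Rk; move/Rsec: Rk; rewrite !(islinB Hf) !(islinZ Hf).
      rewrite (islinD Hf) (islinZ Hf) (islinB Hf) scalerBr => /eqP.
      rewrite subr_eq => /eqP ->.
      by rewrite addrACA subrr addr0 subrK.
    exists 0 => b a k c Rba e; rewrite scaler0 addr0.
    have [k0|k0] := eqVneq k 0.
      by move: e; rewrite k0 scale0r addr0 => e; rewrite e in Rba; exact: Rsec.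
    case: no; exists (k^-1 *: b), (k^-1 *: a), (k^-1 *: c); split.
      by have := Rlin k^-1 _ _ _ _ Rba R0; rewrite !addr0.
    by rewrite (islinZ Hf) -e scalerDr scalerA mulVf // scale1r.
  pose R' : set (B * A) :=
    [set x | exists b a k, R (b, a) /\ x = (b + k *: b0, a + k *: a0)]%classic.
  apply: (Rmax R').
    split; first by case=> b a Rba; exists b, a, 0; rewrite !scale0r !addr0.
    move=> sub; apply: nb0; exists a0; apply: sub; exists 0, 0, 1.
    by rewrite !scale1r !add0r.
  split=> [k b a b' a' [c [d [m [Rcd [-> ->]]]]] [c' [d' [m' [Rcd' [-> ->]]]]]
          |a [b [d [k [Rbd [e ->]]]]]|c a [b [d [k [Rbd [e ->]]]]]].
  - exists (k *: c + c'), (k *: d + d'), (k * m + m'); split; first exact: Rlin.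
    by rewrite !scalerDr !scalerDl !scalerA; congr (_, _); rewrite addrACA.
  - have [k0|k0] := eqVneq k 0.
      move: e Rbd; rewrite k0 !scale0r !addr0 => <-; exact: Rfun.
    case: nb0; exists (- k^-1 *: d).
    have -> : b0 = - k^-1 *: b.
      move/eqP: e; rewrite eq_sym addr_eq0 => /eqP ->.
      by rewrite scaleNr scalerN opprK scalerA mulVf // scale1r.
    by have := Rlin (- k^-1) _ _ _ _ Rbd R0; rewrite !addr0.
  - by apply: Ha0 Rbd _.
have [t Rt] := choice Rtot; exists t; split=> [k x y|a]; last exact: Rsec.
apply/eqP; rewrite -subr_eq0; apply/eqP/Rfun.
have := Rlin (-1) _ _ _ _ (Rlin k _ _ _ _ (Rt x) (Rt y)) (Rt (k *: x + y)).
by rewrite !scaleN1r addNr addrC.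
Qed.

Lemma islin_comp (A B C : lmodType K) (f : A -> B) (h : B -> C) :
  islin f -> islin h -> islin (fun x => h (f x)).
Proof. by move=> Hf Hh a x y; rewrite Hf Hh. Qed.

Lemma islin_sub (A B : lmodType K) (f h : A -> B) :
  islin f -> islin h -> islin (fun x => f x - h x).
Proof. by move=> Hf Hh a x y; rewrite Hf Hh scalerBr opprD addrACA. Qed.

Lemma resolution_contraction (G : lmodType K) (V : nat -> lmodType K)
    (d : forall q, V q -> V q.+1) (iota : G -> V 0%N) :
  (forall q, islin (d q)) -> islin iota -> injective iota ->
  (forall v, d 0%N v = 0 <-> exists m, v = iota m) ->
  (forall q v, d q.+1 (d q v) = 0) ->
  (forall q (v : V q.+1), d q.+1 v = 0 -> exists w, v = d q w) ->
  exists (s : forall q, V q.+1 -> V q) (pi : V 0%N -> G),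
    [/\ forall q, islin (s q), islin pi, forall m, pi (iota m) = m,
        forall v, v = iota (pi v) + s 0%N (d 0%N v) &
        forall q v, v = d q (s q v) + s q.+1 (d q.+1 v)].
Proof.
move=> Hd Hi injI ker0 dd ex.
have [pi [Hpi piI]] := linear_section Hi.
have piK m : pi (iota m) = m by apply: injI.
pose t q := sval (cid (linear_section (Hd q))).
have Ht q : islin (t q) /\ forall v, d q (t q (d q v)) = d q v.
  exact: svalP (cid (linear_section (Hd q))).
(* A projection of [V q] onto the cycles, which by exactness are the image of the preceding map. *)
pose e q : V q -> V q :=
  if q is q'.+1 then fun v => d q' (t q' v) else fun v => iota (pi v).
have e_lin q : islin (e q).
  case: q => [|q]; first exact: (islin_comp Hpi Hi).
  exact: (islin_comp (Ht q).1 (Hd q)).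
have de q v : d q (e q v) = 0.
  by case: q v => [|q] v /=; [apply/ker0; exists (pi v) | exact: dd].
have e_ker q v : d q v = 0 -> e q v = v.
  case: q v => [|q] v /=; first by move/ker0=> [m ->]; rewrite piK.
  by move/ex=> [w ->]; rewrite (Ht q).2.
(* The section [t q] inverts [d q] only modulo cycles. Removing the cycle part of its values gives
   $s d = 1 - e$ on the nose. *)
pose s q (v : V q.+1) := t q v - e q (t q v).
have sd q v : s q (d q v) = v - e q v.
  have E : e q (t q (d q v) - v) = t q (d q v) - v.
    by apply: e_ker; rewrite (islinB (Hd q)) (Ht q).2 subrr.
  rewrite (islinB (e_lin q)) in E; apply/eqP; rewrite /s subr_eq; apply/eqP.
  by rewrite -{1}[t q (d q v)](subrK v) -E addrC addrA addrAC.
have s_lin q : islin (s q).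
  exact: (islin_sub (Ht q).1 (islin_comp (Ht q).1 (e_lin q))).
exists s, pi; split=> // [v|q v]; first by rewrite sd addrC subrK.
by rewrite sd {1}/s (islinB (Hd q)) de subr0 addrC subrK.
Qed.

End Splitting.

(** * The perturbed projection and the lift *)

(* The bracket terms of [ce] commute with any linear map [f], so only the defect
   of equivariance of [f] survives. *)
Lemma ce_comp (K : fieldType) (g : vectType K) (br : g -> g -> g) (M M' : lmodType K)
    (act : g -> M -> M) (act' : g -> M' -> M') (f : M -> M') p
    (c : ('I_p -> g) -> M) (x : 'I_p.+1 -> g) : islin f ->
  ce br act' (fun y => f (c y)) x - f (ce br act c x) =
  alt_sum (fun z v => act' z (f v) - f (act z v)) c x.
Proof.
move=> Hf; rewrite /ce (islinD Hf) opprD addrACA [X in _ + X](_ : _ = 0) ?addr0.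
  rewrite (islin_sum Hf) -sumrB; apply: eq_bigr => i _.
  by rewrite (islinZ Hf) scalerBr.
apply/eqP; rewrite subr_eq0 (islin_sum Hf); apply/eqP/eq_bigr => i _.
by rewrite (islin_sum Hf); apply: eq_bigr => j _; rewrite (islinZ Hf).
Qed.

Lemma ce_equivariant (K : fieldType) (g : vectType K) (br : g -> g -> g)
    (M M' : lmodType K) (act : g -> M -> M) (act' : g -> M' -> M') (f : M -> M') p
    (c : ('I_p -> g) -> M) (x : 'I_p.+1 -> g) : islin f ->
  (forall z v, f (act z v) = act' z (f v)) ->
  ce br act' (fun y => f (c y)) x = f (ce br act c x).
Proof.
move=> Hf equi; apply/eqP; rewrite -subr_eq0 (ce_comp _ act) //; apply/eqP.
by apply: big1 => i _; rewrite equi subrr scaler0.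
Qed.

Section CePointwise.
Variables (K : fieldType) (g : vectType K) (br : g -> g -> g) (M : lmodType K)
  (act : g -> M -> M).
Hypothesis HM : is_gmod br act.

Lemma ceD p (c c' : ('I_p -> g) -> M) x :
  ce br act (fun y => c y + c' y) x = ce br act c x + ce br act c' x.
Proof. exact: (f_equal (fun f => f x) (islinD (ce_islin HM (p := p)) c c')). Qed.

Lemma ceZ p a (c : ('I_p -> g) -> M) x :
  ce br act (fun y => a *: c y) x = a *: ce br act c x.
Proof. exact: (f_equal (fun f => f x) (islinZ (ce_islin HM (p := p)) a c)). Qed.

Lemma ceN p (c : ('I_p -> g) -> M) x :
  ce br act (fun y => - c y) x = - ce br act c x.
Proof. exact: (f_equal (fun f => f x) (islinN (ce_islin HM (p := p)) c)). Qed.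

Lemma ce0 p x : ce br act (fun _ : 'I_p -> g => 0) x = 0.
Proof. exact: (f_equal (fun f => f x) (islin0 (ce_islin HM (p := p)))). Qed.

End CePointwise.

Lemma OmLinear_sub (K : fieldType) (g : vectType K) (V : nat -> lmodType K) k
    (alpha beta : OmV K g V -> Omg K g) :
  OmLinear K g V k alpha -> OmLinear K g V k beta ->
  OmLinear K g V k (fun F p x => alpha F p x - beta F p x).
Proof.
move=> [e1 v1 a1 h1 l1] [e2 v2 a2 h2 l2]; split.
- by move=> F F' eF p x; rewrite (e1 _ _ eF) (e2 _ _ eF).
- by move=> F HF p; apply: cochainB; [exact: v1 | exact: v2].
- move=> F F' HF HF' p x.
  by rewrite (a1 _ _ HF HF') (a2 _ _ HF HF') /addg opprD addrACA.
- by move=> n F HF hF p x ne; rewrite (h1 n) // (h2 n) // subr0.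
- move=> a om F Hom HF p x; rewrite (l1 _ _ _ Hom HF) (l2 _ _ _ Hom HF).
  by rewrite -scalerBr /wedgeg -wedge_sumB.
Qed.

Section Lift.
Unset Implicit Arguments.
Variables (K : fieldType) (g : vectType K) (br : g -> g -> g).
Hypotheses (HK : [pchar K] =i pred0) (Hg : is_lie br).
Variables (V : nat -> lmodType K) (act : forall q, g -> V q -> V q)
  (d : forall q, V q -> V q.+1).
Hypotheses (Hact : forall q, is_gmod br (act q)) (Hd : forall q, islin (d q)).
Hypotheses (Hequi : forall q x v, d q (act q x v) = act q.+1 x (d q v)).
Hypotheses (Hdd : forall q v, d q.+1 (d q v) = 0).
Variable N : nat.
Hypothesis HN : forall q, (N < q)%N -> forall v : V q, v = 0.
Variables (G : lmodType K) (actG : g -> G -> G) (iota : G -> V 0%N).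
Hypotheses (Hiota : islin iota) (iota_equi : forall x m, iota (actG x m) = act 0%N x (iota m)).
Variables (s : forall q, V q.+1 -> V q) (pi : V 0%N -> G).
Hypotheses (Hs : forall q, islin (s q)) (Hpi : islin pi)
  (piK : forall m, pi (iota m) = m)
  (contr0 : forall v, v = iota (pi v) + s 0%N (d 0%N v))
  (contrS : forall q v, v = d q (s q v) + s q.+1 (d q.+1 v)).
Set Implicit Arguments.

Local Notation OmV := (OmV K g V).
Local Notation Omg := (Omg K g).
Local Notation addV := (@Defs.addV K g V).
Local Notation addg := (@Defs.addg K g).
Local Notation validV := (@Defs.validV K g V).
Local Notation dCE := (dCEV K g br V act).
Local Notation dV := (dVV K g V d).
Local Notation D := (dtot K g br V act d).
Local Notation wedgeV := (Defs.wedgeV K g V).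

Lemma OmV_ext (F F' : OmV) : (forall p q x, F p q x = F' p q x) -> F = F'.
Proof.
move=> e; apply: functional_extensionality_dep => p.
by apply: functional_extensionality_dep => q; apply: funext => x.
Qed.

Unset Implicit Arguments.

(** * Operators on $\Omega(V)$ and their relations *)

Definition zeroV : OmV := fun _ _ _ => 0.

(** The Koszul sign of a map of degree $-1$ passing a $p$-form. It cancels against the sign of
    [dVV], and it turns the anticommutator with the Chevalley-Eilenberg part of $D$ into a
    commutator of [ce] with [s], up to sign. *)
Definition opS (F : OmV) : OmV := fun p q x => (-1) ^+ p *: s q (F p q.+1 x).

Definition defect q (z : g) (v : V q.+1) : V q := act q z (s q v) - s q (act q.+1 z v).

Definition opT (F : OmV) : OmV := fun p q =>
  match p as p0 return ('I_p0 -> g) -> V q with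
  | 0%N => fun _ => 0
  | p'.+1 => fun x => (-1) ^+ p'.+1 *: alt_sum (defect q) (F p' q.+1) x
  end.

Definition opJ (F : OmV) : OmV := fun p q =>
  match q as q0 return ('I_p -> g) -> V q0 with
  | 0%N => fun x => iota (pi (F p 0%N x))
  | _.+1 => fun _ => 0
  end.

(** The two pieces serve as the definition because degrees and wedge products are visible on them;
    [opE_homotopy] recovers $1-(DS+SD)$. *)
Definition opE (F : OmV) : OmV := addV (opT F) (opJ F).

Set Implicit Arguments.

Lemma validV_zero : validV zeroV.
Proof. by move=> p q; apply: cochain_zero. Qed.

Lemma validV_add F F' : validV F -> validV F' -> validV (addV F F').
Proof. by move=> HF HF' p q; apply: cochainD. Qed.

Lemma addV0 F : addV F zeroV = F.
Proof. by apply: OmV_ext => p q x; apply: addr0. Qed.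

Lemma add0V F : addV zeroV F = F.
Proof. by apply: OmV_ext => p q x; apply: add0r. Qed.

Lemma addVACA F1 F2 F3 F4 :
  addV (addV F1 F2) (addV F3 F4) = addV (addV F1 F3) (addV F2 F4).
Proof. by apply: OmV_ext => p q x; apply: addrACA. Qed.

Lemma addVI F F1 F2 : addV F1 F = addV F2 F -> F1 = F2.
Proof.
move=> e; apply: OmV_ext => p q x; apply: (@addIr _ (F p q x)).
exact: (congr1 (fun H : OmV => H p q x) e).
Qed.

Lemma dCE_add F F' : dCE (addV F F') = addV (dCE F) (dCE F').
Proof.
apply: OmV_ext => -[|p] q x; first by rewrite /Defs.addV /= addr0.
exact: (ceD (Hact q)).
Qed.

Lemma dV_add F F' : dV (addV F F') = addV (dV F) (dV F').
Proof.
apply: OmV_ext => p [|q] x; first by rewrite /Defs.addV /= addr0.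
by rewrite /Defs.addV /= (islinD (Hd q)) scalerDr.
Qed.

Lemma D_add F F' : D (addV F F') = addV (D F) (D F').
Proof. by rewrite /dtot dCE_add dV_add addVACA. Qed.

Lemma validV_dCE F : validV F -> validV (dCE F).
Proof.
move=> HF [|p] q; first exact: cochain0.
exact: (cochain_ce Hg (Hact q) (HF p q)).
Qed.

Lemma validV_dV F : validV F -> validV (dV F).
Proof.
move=> HF p [|q]; first exact: cochain_zero.
by apply: cochainZ; apply: cochain_comp.
Qed.

Lemma validV_D F : validV F -> validV (D F).
Proof. by move=> HF; apply: validV_add; [exact: validV_dCE | exact: validV_dV]. Qed.

Lemma DD F : validV F -> D (D F) = zeroV.
Proof.
move=> HF; rewrite /dtot dCE_add dV_add.
have cc p q x : dCE (dCE F) p q x = 0.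
  case: p x => [|[|p]] x //=.
    exact: (ce0 (Hact q)).
  exact: (f_equal (fun f => f x) (ce_ce Hg (Hact q) (HF p q))).
have vv p q x : dV (dV F) p q x = 0.
  case: q x => [|[|q]] x //=; first by rewrite (islin0 (Hd _)) scaler0.
  by rewrite (islinZ (Hd _)) Hdd !scaler0.
(* The differentials of [V] are equivariant, so only the sign $(-1)^p$ in [dVV] distinguishes the
   two orders, and [ce] raises $p$ by one. *)
have cv p q x : dCE (dV F) p q x = - dV (dCE F) p q x.
  case: p q x => [|p] [|q] x /=; rewrite ?oppr0 //.
  - by rewrite (islin0 (Hd q)) scaler0 oppr0.
  - exact: (ce0 (Hact 0%N)).
  - rewrite (ceZ (Hact q.+1)) exprS mulN1r scaleNr opprK; congr (_ *: _).
    exact: ce_equivariant.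
apply: OmV_ext => p q x; rewrite -[LHS]/((dCE (dCE F) p q x + dCE (dV F) p q x) +
  (dV (dCE F) p q x + dV (dV F) p q x)).
by rewrite cc vv cv add0r addr0 addNr.
Qed.

Lemma defect_lin q z : islin (defect q z).
Proof.
move=> a u v; rewrite /defect (Hs q) (Hact q).1.2 (Hact q.+1).1.2 (Hs q).
by rewrite scalerBr opprD addrACA.
Qed.

Lemma opS_add F F' : opS (addV F F') = addV (opS F) (opS F').
Proof. by apply: OmV_ext => p q x; rewrite /opS /Defs.addV (islinD (Hs q)) scalerDr. Qed.

Lemma opS_zero : opS zeroV = zeroV.
Proof. by apply: OmV_ext => p q x; rewrite /opS (islin0 (Hs q)) scaler0. Qed.

Lemma opT_add F F' : opT (addV F F') = addV (opT F) (opT F').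
Proof.
apply: OmV_ext => -[|p] q x; rewrite /Defs.addV /= ?addr0 // -scalerDr; congr (_ *: _).
rewrite /alt_sum -big_split; apply: eq_bigr => i _ /=.
by rewrite (islinD (@defect_lin q _)) scalerDr.
Qed.

Lemma opJ_add F F' : opJ (addV F F') = addV (opJ F) (opJ F').
Proof.
apply: OmV_ext => p [|q] x; rewrite /Defs.addV /= ?addr0 //.
by rewrite (islinD Hpi) (islinD Hiota).
Qed.

Lemma opE_add F F' : opE (addV F F') = addV (opE F) (opE F').
Proof. by rewrite /opE opT_add opJ_add addVACA. Qed.

Lemma iter_opE_add k F F' :
  iter k opE (addV F F') = addV (iter k opE F) (iter k opE F').
Proof. by elim: k => //= k ->; apply: opE_add. Qed.

Lemma opE_homotopy F : F = addV (opE F) (addV (D (opS F)) (opS (D F))).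
Proof.
(* The homotopy formula splits by the two parts of $D$: the Chevalley-Eilenberg part yields $T$
   here, the vertical part yields $1-J$ from the contraction in [dS]. *)
have TE p q x : opT F p q x = - (dCE (opS F) p q x + opS (dCE F) p q x).
  case: p x => [|p] x; first by rewrite /opS /= (islin0 (Hs q)) scaler0 addr0 oppr0.
  rewrite /opT /opS /= (ceZ (Hact q)) -(@ce_comp _ _ br _ _ (act q.+1) (act q)) //.
  by rewrite exprS mulN1r !scaleNr -scalerBr.
have dS p q x : F p q x = opJ F p q x + (dV (opS F) p q x + opS (dV F) p q x).
  have sq : (-1) ^+ p * (-1) ^+ p = 1 :> K by rewrite -expr2 sqrr_sign.
  case: q => [|q]; rewrite /opS /= (islinZ (Hs _)) ?(islinZ (Hd _)) !scalerA sq !scale1r.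
    by rewrite add0r -contr0.
  by rewrite add0r -contrS.
rewrite /dtot opS_add; apply: OmV_ext => p q x.
rewrite -[RHS]/((opT F p q x + opJ F p q x) + ((dCE (opS F) p q x + dV (opS F) p q x) +
  (opS (dCE F) p q x + opS (dV F) p q x))).
by rewrite [X in _ = _ + X]addrACA [RHS]addrACA TE addNr add0r -dS.
Qed.

Lemma validV_opS F : validV F -> validV (opS F).
Proof. by move=> HF p q; apply: cochainZ; apply: cochain_comp. Qed.

(** Alternation of $T F$ is not checked on its formula: it is inherited from $E = 1-(DS+SD)$, since
    [D] and [opS] preserve cochains. *)
Lemma validV_opE F : validV F -> validV (opE F).
Proof.
move=> HF p q.
have -> : opE F p q = F p q - (D (opS F) p q + opS (D F) p q).
  apply: funext => x; apply/eqP; rewrite eq_sym subr_eq; apply/eqP.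
  exact: (f_equal (fun H : OmV => H p q x) (opE_homotopy F)).
apply: cochainB => //; apply: cochainD.
  exact/validV_D/validV_opS.
exact/validV_opS/validV_D.
Qed.

Lemma validV_iter_opE k F : validV F -> validV (iter k opE F).
Proof. by move=> HF; elim: k => //= k IH; apply: validV_opE. Qed.

(** As $D D = 0$, both sides equal $D - D S D$. *)
Lemma opE_D F : validV F -> opE (D F) = D (opE F).
Proof.
move=> HF; apply: (@addVI (D (opS (D F)))).
have := opE_homotopy (D F); rewrite DD // opS_zero addV0 => <-.
by have := f_equal D (opE_homotopy F); rewrite (D_add (opE F)) (D_add (D (opS F))) DD ?add0V //; exact: validV_opS.
Qed.

Lemma iter_opE_D k F : validV F -> iter k opE (D F) = D (iter k opE F).
Proof.
by move=> HF; elim: k => //= k ->; rewrite opE_D //; apply: validV_iter_opE.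
Qed.

Lemma opT_opJ F : opT (opJ F) = zeroV.
Proof.
apply: OmV_ext => -[|p] q x //=; rewrite /alt_sum big1 ?scaler0 // => i _.
by rewrite (islin0 (@defect_lin q _)) scaler0.
Qed.

Lemma opJ_opJ F : opJ (opJ F) = opJ F.
Proof. by apply: OmV_ext => p [|q] x //=; rewrite piK. Qed.

Lemma opE_opJ F : opE (opJ F) = opJ F.
Proof. by rewrite /opE opT_opJ opJ_opJ add0V. Qed.

(** $T J = 0$ gives $T E = T T$: [opT] reads only positive degrees of [V], where the output of [opJ]
    vanishes. *)
Lemma opT_iter_opE k F : opT (iter k opE F) = iter k.+1 opT F.
Proof.
by elim: k => //= k IH; rewrite opT_add opT_opJ addV0 IH.
Qed.

Lemma iter_opT_nilpotent F : iter N.+1 opT F = zeroV.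
Proof.
(* The component of $T^k F$ in [V q] is computed from components of [F] in degree [q + k], which is
   beyond the bound [N]. *)
have van k p q x : (N < q + k)%N -> iter k opT F p q x = 0.
  elim: k p q x => [|k IH] p q x lt; first by apply: HN; rewrite addn0 in lt.
  case: p x => [|p] x //=; rewrite /alt_sum big1 ?scaler0 // => i _.
  by rewrite IH ?addSnnS // (islin0 (@defect_lin q _)) scaler0.
by apply: OmV_ext => p q x; apply: van; rewrite addnS ltnS leq_addl.
Qed.

(** Origin of the exponent [N.+1]: $E^{N+1} = T E^N + J E^N = T^{N+1} + J E^N$, and the bound [N] on
    the degrees of [V] kills $T^{N+1}$. *)
Lemma iter_opE_opJ F : iter N.+1 opE F = opJ (iter N opE F).
Proof. by rewrite iterS {1}/opE opT_iter_opE iter_opT_nilpotent add0V. Qed.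

(** $(-1)^p = (-1)^a(-1)^{p-a}$. The sign is carried by the form so that the result is again a wedge
    product, to which the later operators apply. *)
Lemma wedge_opS a om F :
  opS (wedgeV a om F) = wedgeV a (fun y => (-1) ^+ a * om y) (opS F).
Proof.
apply: OmV_ext => p q x; rewrite /opS /Defs.wedgeV wedge_sumZl (wedge_sum_comp _ _ _ (Hs q)).
have [lt|le] := ltnP p a; first by rewrite !wedge_sum_gt // !scaler0.
rewrite -(wedge_sum_comp _ _ _ (f := fun v => (-1) ^+ (p - a) *: v)); last first.
  by move=> b u v; rewrite scalerDr !scalerA mulrC.
by rewrite scalerA -exprD subnKC.
Qed.

Lemma wedge_opJ a om F : opJ (wedgeV a om F) = wedgeV a om (opJ F).
Proof.
apply: OmV_ext => p [|q] x; rewrite /Defs.wedgeV /=; last by rewrite wedge_sum0.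
by rewrite (wedge_sum_comp _ _ _ Hpi) (wedge_sum_comp _ _ _ Hiota).
Qed.

(** No sign remains: the $(-1)^a$ from [alt_sum_wedge] is absorbed by the prefactor of [opT], whose
    exponent drops from $p+1$ to $b+1$ with $p=a+b$. *)
Lemma wedge_opT a om F : opT (wedgeV a om F) = wedgeV a om (opT F).
Proof.
apply: OmV_ext => -[|p] q x.
  by rewrite /Defs.wedgeV /= wedge_sum0.
rewrite /Defs.wedgeV /=; have [lt|le] := ltnP p a.
  rewrite /alt_sum big1 ?scaler0; last first.
    by move=> i _; rewrite wedge_sum_gt // (islin0 (@defect_lin q _)) scaler0.
  (* This covers [a = p.+1] too: the remaining form degree is then [0], where [opT F] vanishes by
     definition. *)
  rewrite wedge_sum0 //; have -> : (p.+1 - a)%N = 0%N; last by [].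
  by apply/eqP; rewrite subn_eq0.
have [b ep] : exists b, p = (a + b)%N by exists (p - a)%N; rewrite subnKC.
rewrite (@alt_sum_wedge _ _ _ _ _ (@defect_lin q) HK (fun b => F b q.+1) a b) //.
rewrite (@wedge_sumE _ _ _ (fun b => opT F b q) a b.+1) ?ep ?addnS //.
have sgn : (-1) ^+ p.+1 * (-1) ^+ a = (-1) ^+ b.+1 :> K.
  by rewrite ep -addnS exprD mulrAC -expr2 sqrr_sign mul1r.
rewrite scalerA sgn scalerA mulrC -scalerA; congr (_ *: _).
rewrite scaler_sumr; apply: eq_bigr => t _.
by rewrite /opT !scalerA mulrC.
Qed.

Lemma wedge_opE a om F : opE (wedgeV a om F) = wedgeV a om (opE F).
Proof.
rewrite /opE wedge_opT wedge_opJ; apply: OmV_ext => p q x.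
by rewrite /Defs.addV /Defs.wedgeV wedge_sumD.
Qed.

Lemma wedge_iter_opE k a om F :
  iter k opE (wedgeV a om F) = wedgeV a om (iter k opE F).
Proof. by elim: k => //= k ->; apply: wedge_opE. Qed.

Local Notation homV := (Defs.homV K g V).

Lemma homV_opS n F : homV n F -> homV (n - 1) (opS F).
Proof.
move=> HF p q x ne; rewrite /opS HF ?(islin0 (Hs q)) ?scaler0 //.
by apply: contraNN ne => /eqP <-; rewrite addnS intS addrAC subrr add0r.
Qed.

Lemma homV_opE n F : homV n F -> homV n (opE F).
Proof.
move=> HF p q x ne; rewrite /opE /Defs.addV.
have -> : opT F p q x = 0.
  case: p x ne => [|p] x ne //=; rewrite /alt_sum big1 ?scaler0 // => i _.
  by rewrite HF ?(islin0 (@defect_lin q _)) ?scaler0 // addnS -addSn.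
case: q ne => [|q] ne /=; last exact: addr0.
by rewrite HF // (islin0 Hpi) (islin0 Hiota) addr0.
Qed.

Lemma homV_iter_opE k n F : homV n F -> homV n (iter k opE F).
Proof. by move=> HF; elim: k => //= k IH; apply: homV_opE. Qed.

(** * Existence of the lift *)

Section Existence.
Variable X : G -> g.
Hypothesis HX : is_LP br actG X.

Definition dg_lift (F : OmV) : Omg := fun p x => X (pi (iter N.+1 opE F p 0%N x)).

Lemma dg_lift_linear : OmLinear K g V 0 dg_lift.
Proof.
have Xpi : islin (fun v => X (pi v)) by apply: islin_comp => //; exact: HX.1.
split.
- by move=> F F' /OmV_ext ->.
- move=> F HF p; rewrite /dg_lift; apply: (cochain_comp Xpi).
  exact: (validV_iter_opE N.+1 HF).
- move=> F F' HF HF' p x; rewrite /dg_lift iter_opE_add.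
  exact: (islinD Xpi).
- move=> n F _ HF p x; rewrite addr0 => ne; rewrite /dg_lift.
  by rewrite (homV_iter_opE N.+1 HF) ?addn0 // (islin0 Xpi).
- move=> a om F _ _ p x; rewrite /dg_lift wedge_iter_opE mul0n scale1r.
  by rewrite /Defs.wedgeV /wedgeg (wedge_sum_comp _ _ _ Xpi).
Qed.

Lemma dg_lift_dgLP : is_dgLP K g br V act d dg_lift.
Proof.
split=> [|F HF p x]; first exact: dg_lift_linear.
rewrite /dg_lift iter_opE_D // iter_opE_opJ; set H := iter N opE F.
rewrite /dtot /Defs.addV [dV _ _ _ _]/= addr0.
case: p x => [|p] x /=; first by rewrite (islin0 Hpi) (islin0 HX.1).
(* [pi] need not be equivariant, but the argument now lies in the image of [iota]: [ce] passes
   through the equivariant map [iota], and [pi] then cancels it. *)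
rewrite (@ce_equivariant _ _ br _ _ actG (act 0%N)) // piK.
have -> : (fun x0 : 'I_p -> g => X (pi (iota (pi (H p 0%N x0))))) =
  (fun y => X (pi (H p 0%N y))) by apply: funext => y; rewrite piK.
by rewrite (@ce_equivariant _ _ br _ _ actG br) //; [exact: HX.1 | exact: HX.2].
Qed.

Lemma opJ_gen m : opJ (genV0 K g V (iota m)) = genV0 K g V (iota m).
Proof.
apply: OmV_ext => p [|q] x //=; case: eqP => _; first by rewrite piK.
by rewrite (islin0 Hpi) (islin0 Hiota).
Qed.

Lemma dg_lift_is_lift : is_dg_lift K g V G iota X dg_lift.
Proof.
move=> m; rewrite /alpha0 /dg_lift.
have -> : iter N.+1 opE (genV0 K g V (iota m)) = genV0 K g V (iota m).
  by elim: N.+1 => //= k ->; rewrite -opJ_gen opE_opJ.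
by rewrite /= piK.
Qed.

End Existence.

(** * Uniqueness up to homotopy, for the difference [beta] of two lifts *)

Section Uniqueness.
Unset Implicit Arguments.
Variable beta : OmV -> Omg.
Hypothesis beta_lin : OmLinear K g V 0 beta.
Hypothesis beta_D : forall F, validV F -> forall p x,
  beta (D F) p x = dCEg K g br (beta F) p x.
Hypothesis beta0 : forall m, alpha0 K g V beta (iota m) = 0.

Definition null_homotopy n (F : OmV) : Omg :=
  fun p x => \sum_(k < n) beta (iter k opE (opS F)) p x.

Set Implicit Arguments.

Lemma beta_add F F' p x : validV F -> validV F' ->
  beta (addV F F') p x = beta F p x + beta F' p x.
Proof. by case: beta_lin => _ _ H _ _ HF HF'; apply: H. Qed.

Lemma beta_zero p x : beta zeroV p x = 0.
Proof.
have := beta_add x validV_zero validV_zero; rewrite addV0 => e.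
by apply: (@addrI _ (beta zeroV p x)); rewrite addr0 -e.
Qed.

(** Validity and value go through one induction, because [beta] is additive only on families of
    cochains. *)
Lemma beta_sum (I : Type) (r : seq I) (H : I -> OmV) P x :
  (forall i, validV (H i)) ->
  validV (fun p q y => \sum_(i <- r) H i p q y) /\
  beta (fun p q y => \sum_(i <- r) H i p q y) P x = \sum_(i <- r) beta (H i) P x.
Proof.
move=> HH; elim: r => [|i r [vr IH]].
  have -> : (fun p q y => \sum_(i <- [::]) H i p q y) = zeroV.
    by apply: OmV_ext => p q y; rewrite big_nil.
  by rewrite big_nil beta_zero; split => //; exact: validV_zero.
have -> : (fun p q y => \sum_(j <- i :: r) H j p q y) =
    addV (H i) (fun p q y => \sum_(j <- r) H j p q y).
  by apply: OmV_ext => p q y; rewrite big_cons.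
by rewrite big_cons beta_add // IH; split => //; apply: validV_add.
Qed.

(** In form degree [0] this is the hypothesis [beta0]; the other components vanish because [beta]
    has degree $0$. *)
Lemma beta_gen v p x : (exists m, v = iota m) -> beta (genV0 K g V v) p x = 0.
Proof.
move=> [m ->]; have [p0|p0] := eqVneq p 0%N.
  by rewrite p0 in x *; rewrite -(beta0 m) /alpha0; congr (beta _ _ _); exact: ord0_fun.
have [_ _ _ hom _] := beta_lin.
apply: (hom 0); last by rewrite addr0.
  by move=> q [|r]; [case: q => [|q]; [exact: cochain0|exact: cochain_zero]|exact: cochain_zero].
by move=> [|q] [|r] y.
Qed.

(* [F - F_0] is the sum of the [e_j^* /\ G_j] with [G_j] in degree [b] equal to
   [(b+1)^-1] times the contraction of [F] by [e_j]; this lowers the output degree. *)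
Lemma beta_opJ P F x : validV F -> opJ F = F -> beta F P x = 0.
Proof.
elim/ltn_ind: P F x => P IH F x HF JF.
set e := vbasis (fullv : {vspace g}).
pose om j (y : 'I_1 -> g) : K^o := coord e j (y ord0).
pose H j : OmV := fun b q => (b.+1%:R)^-1 *: ci e`_j (F b.+1 q).
have e_lin j : islin (coord e j : g -> K^o) by move=> a u v; rewrite linearP.
have om_cochain j : cochain (om j).
  by apply: cochain1 => y a u v; rewrite /ci /om !scons0 e_lin.
have HH j : validV (H j) by move=> b q; apply: cochainZ; apply: cochain_ci.
have HW j : validV (wedgeV 1%N (om j) (H j)).
  move=> p q.
  exact: (@cochain_wedge1 _ _ HK _ (fun b => H j b q) _ p (e_lin j) (fun b => HH j b q)).
have FJ p y : F p 0%N y = iota (pi (F p 0%N y)) by rewrite -{1}JF.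
have FS p q y : F p q.+1 y = 0 by rewrite -JF.
have [vW bW] := beta_sum (index_enum _) x HW.
have -> : F = addV (genV0 K g V (F 0%N 0%N (fun _ => 0)))
    (fun p q y => \sum_j wedgeV 1%N (om j) (H j) p q y).
  apply: OmV_ext => -[|p] q y; rewrite /Defs.addV.
    rewrite big1 ?addr0; last by move=> j _; rewrite /Defs.wedgeV wedge_sum_gt.
    case: q => [|q] /=; last exact: FS.
    by congr (F _ _ _); exact: ord0_fun.
  rewrite (_ : genV0 _ _ _ _ _ _ _ = 0) ?add0r; last by case: q.
  by rewrite (wedge_contraction HK (F := fun b => F b q)).
rewrite beta_add //; last first.
  move=> q [|r]; last exact: cochain_zero.
  by case: q => [|q]; [exact: cochain0 | exact: cochain_zero].
rewrite beta_gen ?add0r; last by exists (pi (F 0%N 0%N (fun _ => 0))).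
rewrite bW big1 // => j _.
have [_ _ _ _ lin] := beta_lin; rewrite lin // mul0n scale1r /wedgeg.
(* In output degree [0] a wedge product with a one-form is zero, so the strong induction needs no
   separate base case. *)
case: P IH x {bW} => [|P] IH x; first by rewrite wedge_sum_gt.
apply: wedge_sum0; have -> : (P.+1 - 1)%N = P by rewrite subn1.
move=> y; apply: IH => //; apply: OmV_ext => p [|q] z.
  by rewrite /H /= !fctE /ci (islinZ Hpi) (islinZ Hiota) -FJ.
by rewrite /H /= !fctE /ci FS scaler0.
Qed.

Lemma null_homotopy_linear n : OmLinear K g V (-1) (null_homotopy n).
Proof.
have [_ vld _ hom lin] := beta_lin; split.
- by move=> F F' /OmV_ext ->.
- move=> F HF p; rewrite /null_homotopy.
  elim: n => [|n IH].
    rewrite (_ : (fun x => _) = 0); first exact: cochain_zero.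
    by apply: funext => x; rewrite big_ord0.
  rewrite (_ : (fun x => _) = (fun x => \sum_(k < n) beta (iter k opE (opS F)) p x) +
    beta (iter n opE (opS F)) p); last by apply: funext => x; rewrite big_ord_recr.
  by apply: cochainD => //; apply/vld/validV_iter_opE/validV_opS.
- move=> F F' HF HF' p x; rewrite /Defs.addg /null_homotopy -big_split.
  apply: eq_bigr => k _ /=; rewrite opS_add iter_opE_add beta_add //.
    exact/validV_iter_opE/validV_opS.
  exact/validV_iter_opE/validV_opS.
- move=> m F HF homF p x ne; rewrite /null_homotopy big1 // => k _.
  apply: (hom (m - 1)); last by rewrite addr0.
    exact/validV_iter_opE/validV_opS.
  exact/homV_iter_opE/homV_opS.
move=> a om F Hom HF p x; rewrite /null_homotopy /= mul1n.
have vk k : validV (iter k opE (opS F)) by exact/validV_iter_opE/validV_opS.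
(* [beta] has degree $0$ and adds no sign, so the $(-1)^a$ produced by [opS] is the Koszul sign
   required in degree $-1$. *)
pose om' y : K^o := (-1) ^+ a * om y.
have Hom' : cochain om' by exact: (cochainZ ((-1) ^+ a) Hom).
have termE k : beta (iter k opE (opS (wedgeV a om F))) p x =
    (-1) ^+ a *: wedge_sum om (beta (iter k opE (opS F)) (p - a)%N) x.
  by rewrite wedge_opS wedge_iter_opE (lin a om') // mul0n scale1r /wedgeg wedge_sumZl.
rewrite (eq_bigr _ (fun k _ => termE (val k))) -scaler_sumr; congr (_ *: _).
rewrite /wedgeg; elim: n => [|n IH].
  by rewrite big_ord0 wedge_sum0 // => y; rewrite big_ord0.
rewrite big_ord_recr IH /= -wedge_sumD; congr (wedge_sum _ _ _).
by apply: funext => y; rewrite big_ord_recr.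
Qed.

Lemma dCEg_add (A A' : Omg) p x :
  dCEg K g br (fun p x => A p x + A' p x) p x =
  dCEg K g br A p x + dCEg K g br A' p x.
Proof.
case: p x => [|p] x /=; first by rewrite addr0.
exact: (ceD (is_gmod_adjoint Hg)).
Qed.

(** Applying $\beta E^k$ to the homotopy formula, with $E D = D E$ and $\beta D = d\beta$, gives
    $\beta E^k = \beta E^{k+1} + d(\beta E^k S) + (\beta E^k S) D$; summing over $k<n$
    telescopes. *)
Lemma null_homotopyE n F p x : validV F ->
  beta F p x = beta (iter n opE F) p x +
    (dCEg K g br (null_homotopy n F) p x + null_homotopy n (D F) p x).
Proof.
move=> HF; rewrite /null_homotopy; elim: n => [|n IH].
  rewrite big_ord0 addr0 -[LHS]addr0; congr (_ + _).
  case: p x => [|p] x //=.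
  rewrite (_ : (fun x => _) = (fun _ => 0)); first by rewrite (ce0 (is_gmod_adjoint Hg)).
  by apply: funext => y; rewrite big_ord0.
have vS := validV_opS HF; have vD := validV_D HF.
have vSn := validV_iter_opE n vS.
have step : beta (iter n opE F) p x = beta (iter n.+1 opE F) p x +
    (dCEg K g br (beta (iter n opE (opS F))) p x + beta (iter n opE (opS (D F))) p x).
  have e := f_equal (iter n opE) (opE_homotopy F).
  rewrite (iter_opE_add n (opE F)) (iter_opE_add n (D (opS F))) in e.
  rewrite {1}e -iterSr iter_opE_D // beta_add; first last.
  - by apply: validV_add; [exact: validV_D | exact/validV_iter_opE/validV_opS].
  - exact: validV_iter_opE.
  by rewrite beta_add ?beta_D //; [exact: validV_D | exact/validV_iter_opE/validV_opS].
rewrite IH step big_ord_recr -addrA; congr (_ + _).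
have -> : dCEg K g br (fun p x => \sum_(k < n.+1) beta (iter k opE (opS F)) p x) p x =
    dCEg K g br (fun p x => \sum_(k < n) beta (iter k opE (opS F)) p x +
      beta (iter n opE (opS F)) p x) p x.
  case: p x {IH step} => [|p] x //=; congr (ce _ _ _ _).
  by apply: funext => y; rewrite big_ord_recr.
by rewrite dCEg_add [LHS]addrC addrACA.
Qed.

Lemma dgLP_null_homotopic : exists h : OmV -> Omg, OmLinear K g V (-1) h /\
  forall F, validV F -> forall p x,
    beta F p x = dCEg K g br (h F) p x + h (D F) p x.
Proof.
exists (null_homotopy N.+1); split=> [|F HF p x]; first exact: null_homotopy_linear.
rewrite (null_homotopyE N.+1) // beta_opJ ?add0r //; first exact: validV_iter_opE.
by rewrite iter_opE_opJ opJ_opJ.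
Qed.

End Uniqueness.

End Lift.

Theorem theorem1p20 (K : fieldType) (HK : [pchar K] =i pred0)
  (g : vectType K) (br : g -> g -> g) (Hg : is_lie br)
  (G : lmodType K) (actG : g -> G -> G) (HG : is_gmod br actG)
  (V : nat -> lmodType K) (act : forall q, g -> V q -> V q)
  (d : forall q, V q -> V q.+1) (HV : is_dgmod br act d)
  (iota : G -> V 0%N) (Hres : is_resolution actG act d iota)
  (X : G -> g) (HX : is_LP br actG X) :
  exists alpha : OmV K g V -> Omg K g,
    [/\ is_dgLP K g br V act d alpha, is_dg_lift K g V G iota X alpha &
        forall alpha' : OmV K g V -> Omg K g,
          is_dgLP K g br V act d alpha' -> is_dg_lift K g V G iota X alpha' ->
          homotopic K g br V act d alpha alpha'].
Proof.
have [Hact Hd Hequi Hdd [N HN]] := HV.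
have [Hiota iota_equi iota_inj ker0 ex] := Hres.
have [s [pi [Hs Hpi piK contr0 contrS]]] :=
  resolution_contraction Hd Hiota iota_inj ker0 Hdd ex.
have lift_dgLP := dg_lift_dgLP HK Hg Hact Hd Hequi Hdd HN Hiota iota_equi Hs Hpi piK
  contr0 contrS HX.
have lift_X : is_dg_lift K g V G iota X (dg_lift act N iota s pi X).
  exact: dg_lift_is_lift.
exists (dg_lift act N iota s pi X); split=> // alpha' [lin' D'] lift'.
move: lift_dgLP lift_X; set alpha := dg_lift _ _ _ _ _ _ => -[lin Da] lift_X.
pose beta F p (x : 'I_p -> g) := alpha' F p x - alpha F p x.
have beta_lin : OmLinear K g V 0 beta by exact: OmLinear_sub.
have beta_D F : validV K g V F -> forall p x,
    beta (dtot K g br V act d F) p x = dCEg K g br (beta F) p x.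
  move=> HF p x; rewrite /beta (D' _ HF) (Da _ HF).
  case: p x => [|p] x /=; first exact: subrr.
  by rewrite (ceD (is_gmod_adjoint Hg)) (ceN (is_gmod_adjoint Hg)).
have beta0 m : alpha0 K g V beta (iota m) = 0.
  by rewrite /alpha0 /beta -!/(alpha0 _ _ _ _ _) lift' lift_X subrr.
have [h [h_lin hE]] := dgLP_null_homotopic HK Hg Hact Hd Hequi Hdd HN Hiota Hs Hpi
  piK contr0 contrS beta_lin beta_D beta0.
exists h; split=> // F HF p x.
by rewrite /addg -addrA -hE // addrC subrK.
Qed.
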